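(* Let $\mathbf K'_0$ be the class of graphs that have the star property, are star-connected, are triangle-free and contain $C_4$ as an induced subgraph, and let $\mathbf K_0$ be the class of right-angled Coxeter groups whose Coxeter graph is in $\mathbf K'_0$. Then (a) $(\mathbf K_0,\preccurlyeq)$ is not homogeneous; (b) $(\mathbf K_0,\preccurlyeq)$ has the independence property, and thus it is unstable.
   Context: A right-angled Coxeter group has a presentation with generating set $S$ (Coxeter basis) and only relations $s^2=e$, $(ss')^2=e$ for some pairs of distinct $s,s'\in S$; its Coxeter graph has vertex set $S$, distinct vertices adjacent iff they commute. $st(v)$ is $v$ with its neighbours; star-connected: $\Gamma-st(v)$ connected for all $v$; star property: $st(v)\not\subseteq st(v')$ for distinct $v,v'$. $A\preccurlyeq B$ iff $A$ is a subgroup of $B$ and some Coxeter basis $S$ of $B$ has $A\cap S$ a Coxeter basis of $A$. $(\mathbf K_0,\preccurlyeq)$ is an abstract elementary class with amalgamation, joint embedding and arbitrarily large models; $\mathfrak M$ denotes its monster model, and for a bounded $A\subseteq\mathfrak M$ and tuples $a,b$, the Galois types satisfy $tp(a/A)=tp(b/A)$ iff some automorphism of $\mathfrak M$ fixing $A$ pointwise sends $a$ to $b$; $S(A)$ is the set of Galois types of finite tuples over $A$. Homogeneous: for every ordinal $\alpha<|\mathfrak M|$ and sequences $(a_i)_{i<\alpha},(b_i)_{i<\alpha}$ in $\mathfrak M$, if $tp((a_i)_{i\in X}/\emptyset)=tp((b_i)_{i\in X}/\emptyset)$ for every finite $X\subseteq\alpha$, then $tp((a_i)_{i<\alpha}/\emptyset)=tp((b_i)_{i<\alpha}/\emptyset)$.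 Independence property: there are a finite $A\subseteq\mathfrak M$ and $P\subseteq S(A)$ such that for every ordinal $\alpha<|\mathfrak M|$ there are $(a_i)_{i<\alpha}$ in $\mathfrak M$ such that for every $X\subseteq\alpha$ there is $b_X\in\mathfrak M$ with $tp(b_Xa_i/A)\in P$ iff $i\in X$. Stable in $\lambda$: at most $\lambda$ Galois types over each model of size $\lambda$; unstable means not stable in any infinite $\lambda$. *)

(* Defs.v *)
From HB Require Import structures.
From mathcomp Require Export all_boot.
From mathcomp Require Export boolp classical_sets functions cardinality.
From mathcomp Require wochoice.
From Stdlib Require Relation_Operators.

Set Implicit Arguments.
Unset Strict Implicit.
Unset Printing Implicit Defensive.

Local Open Scope classical_set_scope.
Local Open Scope card_scope.

Record graph := Graph {
  vert :> Type;
  adj : vert -> vert -> Prop;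
  adj_sym : forall x y, adj x y -> adj y x;
  adj_irr : forall x, ~ adj x x }.

Definition star (Gm : graph) (v : Gm) : set Gm := [set w | w = v \/ adj v w].

Definition induced (Gm : graph) (U : set Gm) : graph :=
  @Graph U (fun x y => adj (val x) (val y))
    (fun x y => @adj_sym Gm (val x) (val y)) (fun x => @adj_irr Gm (val x)).

Definition connected_graph (Gm : graph) : Prop :=
  forall x y : Gm, Relation_Operators.clos_refl_trans Gm (@adj Gm) x y.

Definition star_connected (Gm : graph) : Prop :=
  forall v : Gm, connected_graph (induced (~` star v)).

Definition star_property (Gm : graph) : Prop :=
  forall v w : Gm, v <> w -> ~ (star v `<=` star w).

Definition triangle_free (Gm : graph) : Prop :=
  forall x y z : Gm, ~ [/\ adj x y, adj y z & adj x z].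

Definition C4_adj (i j : 'I_4) : bool := (j == ordS i) || (i == ordS j).

Definition contains_induced_C4 (Gm : graph) : Prop :=
  exists f : 'I_4 -> Gm,
    injective f /\ forall i j, adj (f i) (f j) <-> C4_adj i j.

Definition K0' (Gm : graph) : Prop :=
  [/\ star_property Gm, star_connected Gm, triangle_free Gm
    & contains_induced_C4 Gm].

(** [(x, false)] is the generator [x] and [(x, true)] its formal inverse. *)
Definition word (X : Type) := seq (X * bool).

(** The congruence defining the quotient of the free group on [X] by the normal
    closure of the relators [R]. *)
Inductive word_eq (X : Type) (R : set (word X)) : word X -> word X -> Prop :=
| word_eq_refl w : word_eq R w w
| word_eq_sym w1 w2 : word_eq R w1 w2 -> word_eq R w2 w1
| word_eq_trans w1 w2 w3 :
    word_eq R w1 w2 -> word_eq R w2 w3 -> word_eq R w1 w3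
| word_eq_cat u1 u2 w1 w2 :
    word_eq R u1 u2 -> word_eq R w1 w2 -> word_eq R (u1 ++ w1) (u2 ++ w2)
| word_eq_cancel x b : word_eq R [:: (x, b); (x, ~~ b)] [::]
| word_eq_rel r : R r -> word_eq R r [::].

Section Coxeter.
Variable G : groupType.
Implicit Types A B H S : set G.

Definition word_val S (w : word S) : G :=
  (\prod_(l <- w) if l.2 then (val l.1)^-1 else val l.1)%g.

(** [H] is a subgroup of [G], and is presented by [< S | R >]. *)
Definition presented_by H S (R : set (word S)) : Prop :=
  (forall g, H g <-> exists w : word S, word_val w = g) /\
  (forall w : word S, word_val w = 1%g <-> word_eq R w [::]).

Definition racg_relators S (E : S -> S -> Prop) : set (word S) :=
  [set w | (exists s, w = [:: (s, false); (s, false)]) \/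
           (exists s t, E s t /\
              w = [:: (s, false); (t, false); (s, false); (t, false)])].

(** [S] is a Coxeter basis of [H], which is thereby a right-angled Coxeter
    group. *)
Definition coxeter_basis H S : Prop :=
  exists E : S -> S -> Prop,
    (forall s t, E s t -> s <> t) /\ presented_by H (racg_relators E).

Definition coxeter_adj S (s t : S) : Prop :=
  s <> t /\ commute (val s) (val t).

Fact coxeter_adj_sym S (s t : S) : coxeter_adj s t -> coxeter_adj t s.
Proof. by case=> /nesym nst cst; split. Qed.

Fact coxeter_adj_irr S (s : S) : ~ coxeter_adj s s.
Proof. by case. Qed.

Definition coxeter_graph S : graph :=
  Graph (@coxeter_adj_sym S) (@coxeter_adj_irr S).

Definition is_subgroup H : Prop :=
  [/\ H 1%g, forall x y, H x -> H y -> H (x * y)%g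
    & forall x, H x -> H x^-1%g].

Definition strong_sub A B : Prop :=
  [/\ is_subgroup A, is_subgroup B, A `<=` B
    & exists S, coxeter_basis B S /\ coxeter_basis A (A `&` S)].

End Coxeter.

(** A class of groups, given by its members realized as subgroups of an
    arbitrary ambient group; an abstract group [G] is [[set: G]]. *)
Definition group_class := forall G : groupType, set (set G).

Definition K0 : group_class := fun G =>
  [set H | exists S : set G, coxeter_basis H S /\ K0' (coxeter_graph S)].

(** Ordinals are well-ordered types. Comparing an ordinal [alpha] with the
    cardinal of [M], seen as an initial ordinal, amounts to comparing their
    cardinalities. *)
Record ordinal_number := OrdinalNumber {
  ord_carrier :> Type;
  ord_le : rel ord_carrier;
  ord_wo : wochoice.well_order ord_le }.

Definition card_lt (T U : Type) (A : set T) (B : set U) : Prop :=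
  ~ (B #<= A).

Section Galois.
Variables (K : group_class) (M : groupType).
Implicit Types A B : set M.

Definition automorphism (f : M -> M) : Prop :=
  bijective f /\ {morph f : x y / (x * y)%g}.

Definition bounded A : Prop := card_lt A [set: M].

(** [M] is universal and (strongly) model homogeneous with respect to the
    members of [(K, strong_sub)] of size less than [|M|]. The class [K0] has
    countable Loewenheim-Skolem number and no finite member, so these conditions
    only have their intended meaning for uncountable [M]. *)
Definition monster : Prop :=
  [/\ K [set: M],
      ~ countable [set: M],
      (forall N : groupType, K [set: N] -> card_lt [set: N] [set: M] ->
         exists f : N -> M,
           [/\ {morph f : x y / (x * y)%g}, injective f
             & strong_sub (range f) [set: M]])
    & (forall A B (f : M -> M),
         K A -> K B -> strong_sub A [set: M] -> strong_sub B [set: M] ->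
         bounded A -> bounded B ->
         set_bij A B f -> {in A &, {morph f : x y / (x * y)%g}} ->
         exists g : M -> M, automorphism g /\ {in A, g =1 f})].

(** [tp(a/A)], as the orbit of [a] under the automorphisms fixing [A]. *)
Definition gtp A (I : Type) (a : I -> M) : set (I -> M) :=
  [set b | exists f : M -> M,
     [/\ automorphism f, forall x, A x -> f x = x
       & forall i, f (a i) = b i]].

Definition fin_type := {n : nat & set ('I_n -> M)}.

Definition fin_gtp A n (a : 'I_n -> M) : fin_type := existT _ n (gtp A a).

Definition galois_types A : set fin_type :=
  [set t | exists n (a : 'I_n -> M), t = fin_gtp A a].

Definition pair_tuple (x y : M) : 'I_2 -> M :=
  fun i => if i == ord0 then x else y.

Definition homogeneous : Prop :=
  forall alpha : ordinal_number, card_lt [set: alpha] [set: M] ->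
  forall a b : alpha -> M,
    (forall X : set alpha, finite_set X ->
       gtp set0 (fun i : X => a (val i)) = gtp set0 (fun i : X => b (val i))) ->
    gtp set0 a = gtp set0 b.

Definition independence_property : Prop :=
  exists A (P : set fin_type),
    [/\ finite_set A, P `<=` galois_types A
      & forall alpha : ordinal_number, card_lt [set: alpha] [set: M] ->
        exists a : alpha -> M, forall X : set alpha,
        exists b : M, forall i, P (fin_gtp A (pair_tuple b (a i))) <-> X i].

(** The cardinal [lambda] is represented by a type of that size. *)
Definition stable_in (L : Type) : Prop :=
  forall A, K A -> strong_sub A [set: M] -> A #= [set: L] ->
    galois_types A #<= [set: L].

Definition unstable : Prop :=
  forall L : Type, infinite_set [set: L] -> card_lt [set: L] [set: M] ->
    ~ stable_in L.

End Galois.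

(* Main.v *)
Require Import Defs.
From HB Require Import structures.
From mathcomp Require Import zify.
From Stdlib Require Import ZArith Relation_Operators.
From Stdlib Require Eqdep_dec.

Set Implicit Arguments.
Unset Strict Implicit.
Unset Printing Implicit Defensive.

Local Open Scope classical_set_scope.
Local Open Scope card_scope.
Local Open Scope group_scope.

(** The key fact is strong rigidity: in a right-angled Coxeter group whose graph
    is in [K0'], all Coxeter bases are conjugate.  The members of a second basis
    are reflections; by triangle-freeness they are recognized through the sizes
    of their centralizers, and star-connectedness shows that their walls bound
    a common chamber, which is located at any edge of the graph.  Rigidity makes
    [strong_sub] transitive along embeddings into the monster model [M], so that
    any small extension of triangle-free graphs is realized in [M].

    For the independence property one adjoins, to an independent set of
    vertices, a vertex commuting with a prescribed subset of it; this yields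
    [2 ^ lambda] types over a model of size [lambda].

    Homogeneity fails for the vertices [s n] of a half graph ([s n] adjacent to
    [t m] iff [n < m]) and their conjugates by [t 0 * ... * t n]: any finitely
    many of these pairs are conjugate by one element.  If an automorphism [f]
    carried one sequence to the other, choose [b] commuting with the [s n] but
    with no further element of a countable model containing the preimages [y k]
    of the conjugates of [t k] by [t 0 * ... * t (k - 1)].  Since [f b] is
    supported on finitely many vertices, it commutes with the conjugate of
    [t k] for large [k], so [y k] is a product of the [s n], which is impossible
    in the abelianization. *)

(** * Words in a right-angled Coxeter system *)

(** Generators are involutions, so words are plain lists without formal inverses, unlike in
    [word_eq]; [basis_psys] and [psys_basis] translate between the two. *)
Inductive weq (Gm : graph) : seq Gm -> seq Gm -> Prop :=
| weq_refl w : weq w w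
| weq_sym u v : weq u v -> weq v u
| weq_trans v u w : weq u v -> weq v w -> weq u w
| weq_del u v x : weq (u ++ x :: x :: v) (u ++ v)
| weq_swap u v x y : adj x y -> weq (u ++ x :: y :: v) (u ++ y :: x :: v).

Lemma weq_invariant (Gm : graph) (T : Type) (h : seq Gm -> T) :
  (forall u v x, h (u ++ x :: x :: v) = h (u ++ v)) ->
  (forall u v x y, adj x y -> h (u ++ x :: y :: v) = h (u ++ y :: x :: v)) ->
  forall u v, weq u v -> h u = h v.
Proof.
by move=> hd hs u v; elim=> {u v} [//|u v _ -> //|v u w _ -> _ -> //|//|u v x y /hs].
Qed.

Lemma weq_cat2 (Gm : graph) (a b u v : seq Gm) :
  weq u v -> weq (a ++ u ++ b) (a ++ v ++ b).
Proof.
elim=> {u v} [w|u v _|v u w _ + _|u v x|u v x y xy].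
- exact: weq_refl.
- exact: weq_sym.
- exact: weq_trans.
- by rewrite -!catA !catA -(catA _ _ b) -(catA _ v b) /=; exact: weq_del.
- by rewrite -!catA !catA -!(catA _ _ b) /=; exact: weq_swap.
Qed.

Lemma weq_cat (Gm : graph) (u u' v v' : seq Gm) :
  weq u u' -> weq v v' -> weq (u ++ v) (u' ++ v').
Proof.
move=> uu vv; apply: (@weq_trans _ (u' ++ v)).
  exact: (weq_cat2 [::] v uu).
by have := weq_cat2 u' [::] vv; rewrite !cats0.
Qed.

Lemma weq_revK (Gm : graph) (w : seq Gm) : weq (rev w ++ w) [::].
Proof.
elim: w => [|x w IH]; first exact: weq_refl.
by rewrite rev_cons cat_rcons; apply: weq_trans IH; exact: weq_del.
Qed.

Lemma weq_pmap (Gm Dm : graph) (e : Gm -> option Dm) (u v : seq Gm) :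
  (forall x y x' y', adj x y -> e x = Some x' -> e y = Some y' -> adj x' y') ->
  weq u v -> weq (pmap e u) (pmap e v).
Proof.
move=> eadj; elim=> {u v} [w|u v _|v u w _ + _|u v x|u v x y xy].
- exact: weq_refl.
- exact: weq_sym.
- exact: weq_trans.
- rewrite !pmap_cat /=; case: (e x) => [x'|] /=; [exact: weq_del | exact: weq_refl].
- rewrite !pmap_cat /=; case ex: (e x) => [x'|]; case ey: (e y) => [y'|] /=;
    try exact: weq_refl.
  by apply: weq_swap; exact: eadj ex ey.
Qed.

Definition cev (Gm : graph) (G : groupType) (c : Gm -> G) (w : seq Gm) : G :=
  \prod_(x <- w) c x.

(** This expresses that [c] extends to an injective morphism from the abstract right-angled Coxeter
    group of [Gm] into [G]; only [coxsys] requires the image to be all of [G]. *)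
Record psys (Gm : graph) (G : groupType) (c : Gm -> G) : Prop := PSys {
  psysV : forall x, c x * c x = 1;
  psysC : forall x y, adj x y -> commute (c x) (c y);
  psysP : forall w, cev c w = 1 -> weq w [::] }.

Definition coxsys (Gm : graph) (G : groupType) (c : Gm -> G) : Prop :=
  psys c /\ forall g, exists w, cev c w = g.

Lemma cev_nil (Gm : graph) (G : groupType) (c : Gm -> G) : cev c [::] = 1.
Proof. exact: big_nil. Qed.

Lemma cev_cons (Gm : graph) (G : groupType) (c : Gm -> G) x w :
  cev c (x :: w) = c x * cev c w.
Proof. exact: big_cons. Qed.

Lemma cev1 (Gm : graph) (G : groupType) (c : Gm -> G) x : cev c [:: x] = c x.
Proof. exact: big_seq1. Qed.

Lemma cev_cat (Gm : graph) (G : groupType) (c : Gm -> G) u v :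
  cev c (u ++ v) = cev c u * cev c v.
Proof. exact: big_cat. Qed.

Lemma cev_map (Gm Dm : graph) (G : groupType) (c : Dm -> G) (e : Gm -> Dm) w :
  cev c (map e w) = cev (c \o e) w.
Proof. exact: big_map. Qed.

Lemma morph_cev (Gm : graph) (G G' : groupType) (c : Gm -> G) (f : G -> G') :
  {morph f : x y / x * y} -> forall w, f (cev c w) = cev (f \o c) w.
Proof.
move=> fM.
have f1 : f 1 = 1 by apply: (mulgI (f 1)); rewrite -fM !mulg1.
by elim=> [|x w IH]; rewrite ?cev_nil // !cev_cons fM IH.
Qed.

Lemma weq_cev (Gm : graph) (G : groupType) (c : Gm -> G) u v :
  (forall x, c x * c x = 1) -> (forall x y, adj x y -> commute (c x) (c y)) ->
  weq u v -> cev c u = cev c v.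
Proof.
move=> cV cC; apply: weq_invariant => [{}u {}v x|{}u {}v x y xy].
  by rewrite !cev_cat !cev_cons (mulgA (c x)) cV mul1g.
by rewrite !cev_cat !cev_cons !(mulgA (c _)) cC.
Qed.

Lemma psys_eqP (Gm : graph) (G : groupType) (c : Gm -> G) u v :
  psys c -> cev c u = cev c v <-> weq u v.
Proof.
move=> hc; split=> [uv|]; last by apply: weq_cev; case: hc.
have H : weq (rev v ++ u) [::].
  apply: (psysP hc); rewrite cev_cat uv -cev_cat.
  rewrite (@weq_cev _ _ c _ [::]) ?cev_nil //; try by case: hc.
  exact: weq_revK.
apply: (@weq_trans _ (v ++ rev v ++ u)).
  rewrite catA -[X in weq X]cat0s; apply: weq_sym; apply: weq_cat (weq_refl u).
  by have := weq_revK (rev v); rewrite revK.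
by rewrite -[X in weq _ X]cats0; apply: weq_cat H; exact: weq_refl.
Qed.

Lemma psys_inv (Gm : graph) (G : groupType) (c : Gm -> G) x :
  psys c -> (c x)^-1 = c x.
Proof. by move=> hc; apply: mulg1_eq; exact: psysV hc x. Qed.

Lemma psys_morph (Gm : graph) (G G' : groupType) (c : Gm -> G) (f : G -> G') :
  psys c -> {morph f : x y / x * y} -> injective f -> psys (f \o c).
Proof.
move=> hc fM fI.
have f1 : f 1 = 1 by apply: (mulgI (f 1)); rewrite -fM !mulg1.
split=> [x|x y xy|w] /=.
- by rewrite -fM (psysV hc).
- by rewrite /commute /= -!fM (psysC hc xy).
- by rewrite -morph_cev // -f1 => /fI; exact: psysP.
Qed.

Lemma coxsys_morph (Gm : graph) (G G' : groupType) (c : Gm -> G) (f : G -> G') :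
  coxsys c -> {morph f : x y / x * y} -> bijective f -> coxsys (f \o c).
Proof.
move=> [hc hg] fM [f' fK fK']; split; first exact: psys_morph hc fM (can_inj fK).
move=> g; have [w wE] := hg (f' g); exists w.
by rewrite -morph_cev // wE fK'.
Qed.

Lemma conjg_morph (G : groupType) (g : G) : {morph (fun x => x ^ g) : x y / x * y}.
Proof. by move=> x y; rewrite conjMg. Qed.

Lemma conjg_bij (G : groupType) (g : G) : bijective (fun x => x ^ g).
Proof. by exists (fun x => x ^ g^-1) => x; rewrite -conjgM ?mulgV ?mulVg conjg1. Qed.

Definition induced_emb (Gm Dm : graph) (e : Gm -> Dm) : Prop :=
  injective e /\ forall x y, adj (e x) (e y) <-> adj x y.

(* Killing the generators outside the image of [e] retracts onto the
   subgroup generated by the remaining ones. *)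
Lemma psys_sub (Gm Dm : graph) (G : groupType) (c : Dm -> G) (e : Gm -> Dm) :
  induced_emb e -> psys c -> psys (c \o e).
Proof.
move=> [eI eadj] hc; split=> [x|x y /eadj xy|w] /=.
- exact: psysV.
- exact: psysC xy.
rewrite -cev_map => /(psysP hc).
pose r (y : Dm) : option Gm :=
  if pselect (exists x, e x = y) is left h then Some (sval (cid h)) else None.
have rP y x : r y = Some x -> e x = y.
  by rewrite /r; case: pselect => // h [<-]; case: cid.
have rK x : r (e x) = Some x.
  rewrite /r; case: pselect => [h|[]]; last by exists x.
  by congr Some; apply: eI; case: cid.
move=> /(@weq_pmap _ _ r)-/(_ _)/=; rewrite map_pK //.
apply => x y x' y' xy /rP x'E /rP y'E.
by apply/eadj; rewrite x'E y'E.
Qed.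

(** * The cocycle of walls *)

Section System.
Variables (Gm : graph) (G : groupType) (c : Gm -> G) (hc : coxsys c).
Let hp : psys c := proj1 hc.

Lemma cinv x : (c x)^-1 = c x. Proof. exact: psys_inv. Qed.
Lemma cK x : c x * c x = 1. Proof. exact: psysV hp x. Qed.
Lemma cKg x g : c x * (c x * g) = g. Proof. by rewrite mulgA cK mul1g. Qed.
Lemma cgK x g : g * c x * c x = g. Proof. by rewrite -mulgA cK mulg1. Qed.

Definition wd (g : G) : seq Gm := sval (cid (proj2 hc g)).
Lemma wdK g : cev c (wd g) = g. Proof. by rewrite /wd; case: cid. Qed.

Lemma wd_weq w : weq (wd (cev c w)) w.
Proof. by apply/(psys_eqP _ _ hp); rewrite wdK. Qed.

Lemma cword_ind (P : G -> Prop) :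
  P 1 -> (forall x g, P g -> P (c x * g)) -> forall g, P g.
Proof.
move=> P1 PS g; rewrite -(wdK g); elim: (wd g) => [|x w IH].
  by rewrite cev_nil.
by rewrite cev_cons; exact: PS.
Qed.

Lemma cwordr_ind (P : G -> Prop) :
  P 1 -> (forall x g, P g -> P (g * c x)) -> forall g, P g.
Proof.
move=> P1 PS g; rewrite -(wdK g); elim/last_ind: (wd g) => [|w x IH].
  by rewrite cev_nil.
by rewrite -cats1 cev_cat cev1; exact: PS.
Qed.

(** The parity of the number of times the gallery of type [w] from the chamber [1] crosses the wall
    of [r]. Conjugating [r] re-bases the rest of the gallery at [1]. *)
Fixpoint sepw (w : seq Gm) (r : G) : bool :=
  if w is x :: w' then (r == c x) (+) sepw w' (r ^ c x) else false.

Lemma sepw_cat u v r : sepw (u ++ v) r = sepw u r (+) sepw v (r ^ cev c u).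
Proof.
elim: u r => [|x u IH] r /=; first by rewrite cev_nil conjg1.
by rewrite IH cev_cons conjgM addbA.
Qed.

Lemma conjcc x r : (r ^ c x) ^ c x = r.
Proof. by rewrite -conjgM cK conjg1. Qed.

Lemma conjc_comm x y : commute (c x) (c y) -> c x ^ c y = c x.
Proof. by move=> h; rewrite conjgE h mulgA mulVg mul1g. Qed.

Lemma conj_eq (g r r' : G) : (r ^ g == r' ^ g) = (r == r').
Proof. exact: (eqtype.inj_eq (@conjg_inj _ g)). Qed.

Lemma conj_eqc x r : (r ^ c x == c x) = (r == c x).
Proof.
by rewrite -{2}(conjc_comm (commute_refl (c x))) conj_eq.
Qed.

(** Cancelling a square removes two crossings of one wall; exchanging commuting letters crosses the
    same two walls in the other order. *)
Lemma sepw_weq u v : weq u v -> sepw u = sepw v.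
Proof.
apply: weq_invariant => [{}u {}v x|{}u {}v x y xy]; apply/funext => r.
  by rewrite !sepw_cat /= conj_eqc conjcc addKb.
rewrite !sepw_cat /=; congr (_ (+) _); move: (r ^ _) => {}r.
have cxy := psysC hp xy.
have -> : (r ^ c x == c y) = (r == c y).
  by rewrite -{1}(conjc_comm (commute_sym cxy)) conj_eq.
have -> : (r ^ c y == c x) = (r == c x) by rewrite -{1}(conjc_comm cxy) conj_eq.
by rewrite -!conjgM cxy addbCA.
Qed.

(** [sep g r] tells whether the wall of the reflection [r] separates the chambers
    [1] and [g]. *)
Definition sep (g r : G) : bool := sepw (wd g) r.

Lemma sep_cev w r : sep (cev c w) r = sepw w r.
Proof. by rewrite /sep (sepw_weq (wd_weq w)). Qed.

Lemma sep1 r : sep 1 r = false.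
Proof. by rewrite -[1](cev_nil c) sep_cev. Qed.

Lemma sepM g h r : sep (g * h) r = sep g r (+) sep h (r ^ g).
Proof. by rewrite -{1}(wdK g) -{1}(wdK h) -cev_cat sep_cev sepw_cat wdK. Qed.

Lemma sepc x r : sep (c x) r = (r == c x).
Proof. by rewrite -{1}(cev1 c) sep_cev /= addbF. Qed.

Lemma sepV g r : sep g^-1 r = sep g (r ^ g^-1).
Proof.
have := sepM g^-1 g r; rewrite mulVg sep1.
by case: (sep g^-1 r); case: (sep g _).
Qed.

Lemma sep_self g x : sep (c x ^ g) (c x ^ g).
Proof.
rewrite {1}conjgE !sepM sepV sepc conjgK eqxx (conjc_comm (commute_refl _)).
by case: (sep g _).
Qed.

(** The coordinate at [x] of the abelianization, a sum of copies of Z/2. *)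
Definition chi (x : Gm) (g : G) : bool := odd (count (fun y => `[<y = x>]) (wd g)).

Lemma chi_cev x w : chi x (cev c w) = odd (count (fun y => `[<y = x>]) w).
Proof.
rewrite /chi; apply: (weq_invariant (h := fun w => odd (count (fun y => `[<y = x>]) w)));
  last exact: wd_weq.
  by move=> u v y; rewrite !count_cat /= !oddD !oddb addKb.
by move=> u v y z _; rewrite !count_cat /= !oddD !oddb (addbCA `[<y = x>]).
Qed.

Lemma chiM x g h : chi x (g * h) = chi x g (+) chi x h.
Proof. by rewrite -{1}(wdK g) -{1}(wdK h) -cev_cat chi_cev count_cat oddD. Qed.

Lemma chi1 x : chi x 1 = false.
Proof. by rewrite -(cev_nil c) chi_cev. Qed.

Lemma chic x y : chi x (c y) = `[<y = x>].
Proof. by rewrite -(cev1 c) chi_cev /= addn0 oddb. Qed.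

Lemma chiV x g : chi x g^-1 = chi x g.
Proof. by have := chiM x g^-1 g; rewrite mulVg chi1; do 2!case: chi. Qed.

Lemma chiJ x g h : chi x (g ^ h) = chi x g.
Proof. by rewrite conjgE !chiM chiV addbC -addbA addbb addbF. Qed.

Lemma c_inj : injective c.
Proof. by move=> x y xy; apply/asboolP; rewrite -chic xy chic asboolE. Qed.

Lemma c_eqE x y : (c x == c y) = `[<x = y>].
Proof. by apply/eqP/asboolP => [/c_inj|->]. Qed.

Lemma cJ_inj x y g : c x ^ g = c y -> x = y.
Proof. by move=> /(congr1 (chi y)); rewrite chiJ !chic (asboolT (erefl y)) => /asboolP. Qed.

Lemma c_neq1 x : c x <> 1.
Proof. by move=> /(congr1 (chi x)); rewrite chic chi1 asboolT. Qed.

(** * The contragredient reflection representation *)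

Local Open Scope Z_scope.

(** A functional [f] is recorded by its values on the simple roots. The bilinear form is -1 on the
    roots of two non-commuting generators, whence the coefficient 2. The constant 1 from which
    [actw] starts is a point inside the fundamental chamber. *)
Definition act (x : Gm) (f : Gm -> Z) : Gm -> Z := fun y =>
  if `[<y = x>] then - f x else if `[<adj x y>] then f y else f y + 2 * f x.

Lemma act_id x f : act x f x = - f x.
Proof. by rewrite /act asboolT. Qed.

Lemma act_adj x y f : adj x y -> act x f y = f y.
Proof.
move=> xy; rewrite /act (asboolF (P := y = x)) ?asboolT //.
by move=> yx; apply: (@adj_irr Gm x); rewrite -{2}yx.
Qed.

Lemma act_far x y f : y <> x -> ~ adj x y -> act x f y = f y + 2 * f x.
Proof. by move=> yx xy; rewrite /act !asboolF. Qed.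

Lemma actK x f : act x (act x f) = f.
Proof.
apply/funext => y; case: (pselect (y = x)) => [->|yx]; first by rewrite !act_id; lia.
case: (pselect (adj x y)) => xy; first by rewrite !act_adj.
by rewrite act_far // act_id act_far //; lia.
Qed.

Lemma actC x y f : adj x y -> act x (act y f) = act y (act x f).
Proof.
move=> xy; have yx := adj_sym xy; apply/funext => z.
case: (pselect (z = x)) => [->|zx]; first by rewrite !(act_id, act_adj).
case: (pselect (z = y)) => [->|zy]; first by rewrite !(act_id, act_adj).
case: (pselect (adj x z)) => xz; case: (pselect (adj y z)) => yz;
  rewrite ?(act_adj _ xz) ?(act_adj _ yz) ?(act_far _ _ xz) ?(act_far _ _ yz)
    ?(act_adj _ xz) ?(act_adj _ yz) ?(act_far _ _ xz) ?(act_far _ _ yz)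
    ?(act_adj _ xy) ?(act_adj _ yx) //; lia.
Qed.

Definition actw (w : seq Gm) : Gm -> Z := foldr act (fun=> 1) w.

Definition coord (g : G) : Gm -> Z := actw (wd g).

Lemma coord_cev w : coord (cev c w) = actw w.
Proof.
apply: (weq_invariant (h := actw)); last exact: wd_weq.
  by move=> u v x; rewrite /actw !foldr_cat /= actK.
by move=> u v x y xy; rewrite /actw !foldr_cat /= actC.
Qed.

Lemma coord1 x : coord 1 x = 1.
Proof. by rewrite -(cev_nil c) coord_cev. Qed.

Lemma coordM x g : coord (c x * g) = act x (coord g).
Proof. by rewrite -{1}(wdK g) -cev_cons coord_cev. Qed.

Lemma adj_commute x y : x <> y -> commute (c x) (c y) -> adj x y.
Proof.
move=> xy cxy; apply: contrapT => nxy.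
have nyx : ~ adj y x by move=> /adj_sym.
have coordc z : coord (c z) = act z (coord 1) by rewrite -coordM mulg1.
(* The coordinate at [x] is -3 for [c x * c y] and 5 for [c y * c x]. *)
have := congr1 (coord^~ x) cxy; rewrite /= !coordM !coordc act_id act_far //.
by rewrite (act_far _ xy nyx) act_id act_far ?coord1 //; apply/nesym.
Qed.

(* [out n g]: [g] is reached from [1] by [n] left multiplications, each of
   which leaves the positive side of the wall it crosses. *)
Inductive out : nat -> G -> Prop :=
| out0 : out 0 1%g
| outS n x g : out n g -> 0 < coord g x -> out n.+1 (c x * g)%g.

Lemma out_pos n g : out n g ->
  (forall x, coord g x <> 0) /\ (forall x y, x <> y -> ~ adj x y -> 0 < coord g x + coord g y).
Proof.
elim=> {n g} [|n x g _ [IH0 IH] gx]; first by split=> *; rewrite !coord1.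
have far y : y <> x -> ~ adj x y -> 0 < coord g y + 2 * coord g x.
  by move=> /IH yx xy; have := yx (fun h => xy (adj_sym h)); lia.
split=> [y|y z yz nyz]; rewrite coordM.
- case: (pselect (y = x)) => [->|yx]; first by rewrite act_id; lia.
  case: (pselect (adj x y)) => xy; first by rewrite act_adj.
  by rewrite act_far //; have := far _ yx xy; lia.
- case: (pselect (y = x)) => [yx|yx].
    rewrite yx act_id act_far; try by rewrite -yx // => /esym.
    by have := IH y z yz nyz; rewrite yx; lia.
  case: (pselect (z = x)) => [zx|zx].
    rewrite zx act_id act_far //; last by rewrite -zx => /adj_sym.
    by have := IH y z yz nyz; rewrite zx; lia.
  have := IH y z yz nyz.
  by case: (pselect (adj x y)) => xy; case: (pselect (adj x z)) => xz;
    rewrite ?(act_adj _ xy) ?(act_adj _ xz) ?(act_far _ _ xy) ?(act_far _ _ xz) //; lia.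
Qed.

(** An exchange condition: if the letter [y] multiplied last is not [x], a negative coordinate at
    [x] forces [x] and [y] to be adjacent, so the cancellation of [x] can be moved past [y]. *)
Lemma out_neg n g x : out n g -> coord g x < 0 ->
  exists2 m, n = m.+1 & out m (c x * g)%g.
Proof.
move=> og; elim: og x => {n g} [|n y g og IH gy] x; first by rewrite coord1; lia.
have [p0 pI] := out_pos (outS og gy).
case: (pselect (x = y)) => [->|xy] gx; first by exists n; rewrite ?cKg.
have gy' : coord (c y * g) y < 0 by rewrite coordM act_id; lia.
have axy : adj y x.
  apply: contrapT => nyx; have := pI y x (fun h => xy (esym h)) nyx; lia.
move: gx; rewrite coordM act_adj // => gx.
have [m -> om] := IH _ gx; exists m.+1 => //.
rewrite mulgA -(psysC hp axy) -mulgA; apply: outS => //.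
by rewrite coordM act_adj //; exact: adj_sym.
Qed.

Lemma out_all g : exists n, out n g.
Proof.
elim/cword_ind: g => [|x g [n og]]; first by exists 0%nat; exact: out0.
have [p0 _] := out_pos og.
case: (Z.lt_total (coord g x) 0) => [|[|]] gx.
- by have [m _ om] := out_neg og gx; exists m.
- by case: (p0 x).
- by exists n.+1; exact: outS.
Qed.

Lemma coord_neq0 g x : coord g x <> 0.
Proof. by have [n /out_pos[]] := out_all g. Qed.

Lemma coord_far g x y : x <> y -> ~ adj x y -> 0 < coord g x + coord g y.
Proof. by have [n /out_pos[_]] := out_all g; apply. Qed.

Let e (g : G) (s : Gm) : bool := (coord g s <? 0).

Lemma e_id g x : e (c x * g)%g x = ~~ e g x.
Proof. by rewrite /e coordM act_id; have := @coord_neq0 g x; lia. Qed.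

Lemma e_adj g x y : adj x y -> e (c x * g)%g y = e g y.
Proof. by move=> xy; rewrite /e coordM act_adj. Qed.

Lemma e_far g x y : ~~ e g x -> y <> x -> ~ adj x y -> e (c x * g)%g y = false.
Proof.
move=> gx yx xy; rewrite /e coordM act_far //.
have := coord_far g yx (fun h => xy (adj_sym h)).
by move: gx; rewrite /e; have := @coord_neq0 g x; lia.
Qed.

(** Right multiplication by [c x] leads to a neighbouring chamber, and only the sign for the wall
    between the two may change. The induction peels letters off the left of [g]. *)
Lemma eM g x s : e (g * c x)%g s = e g s (+) ((c s ^ g)%g == c x).
Proof.
have [n og] := out_all g; elim: og x s => {n g} [|n y h _ IH hy] x s.
  rewrite mul1g conjg1 c_eqE /e coord1 -[c x]mulg1 coordM /=.
  case: (pselect (s = x)) => [->|sx]; first by rewrite act_id coord1 asboolT.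
  rewrite (asboolF sx).
  case: (pselect (adj x s)) => xs; first by rewrite act_adj // coord1.
  by rewrite act_far // !coord1.
have {}hy : ~~ e h y by rewrite /e; lia.
rewrite -mulgA conjgM.
case: (pselect (s = y)) => [->|sy].
  by rewrite !e_id IH (conjc_comm (commute_refl _)) addNb.
case: (pselect (adj y s)) => ys.
  by rewrite !e_adj // IH (conjc_comm (commute_sym (psysC hp ys))).
rewrite [e (c y * h)%g s]e_far // -conjgM.
suff E0 : e (c y * (h * c x))%g s = false.
  rewrite E0 /=; apply/esym/negP => /eqP sx.
  suff : e (c y * (h * c x))%g s by rewrite E0.
  rewrite mulgA -sx conjgE mulgA mulgA mulgV mul1g e_id e_far //.
(* If [h * c x] is beyond the wall of [c y] while [h] is not, this wall is the one between them;
   then [c y * (h * c x)] is [h] itself. *)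
case hxy: (e (h * c x)%g y); last by rewrite e_far ?hxy.
move: hxy; rewrite IH (negbTE hy) /= => /eqP yx.
have hxE : (h * c x = c y * h)%g by rewrite -yx conjgE mulgA mulgA mulgV mul1g.
have := IH x s; rewrite hxE cKg e_far // -yx conj_eq c_eqE.
by rewrite (asboolF sy) addbF => <-.
Qed.

Lemma sign_sep g s : e g s = sep g (c s).
Proof.
elim/cwordr_ind: g => [|x g IH]; first by rewrite /e coord1 sep1.
by rewrite eM sepM sepc IH.
Qed.

(** Coordinates at two non-adjacent vertices have a positive sum, so they are not both negative. *)
Lemma sep_desc g s t : sep g (c s) -> sep g (c t) -> s <> t -> adj s t.
Proof.
rewrite -!sign_sep /e => gs gt st; apply: contrapT => /(coord_far g st); lia.
Qed.

End System.

(** * Parabolic subgroups, centralizers and involutions *)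

Lemma conj_commute (G : groupType) (x y g : G) :
  commute (x ^ g) (y ^ g) <-> commute x y.
Proof. by rewrite /commute -!conjMg; split=> [/conjg_inj|->]. Qed.

Lemma conjg_commute (G : groupType) (x y : G) : commute x y -> x ^ y = x.
Proof. by move=> h; rewrite conjgE h mulgA mulVg mul1g. Qed.

Section Centralizers.
Variables (Gm : graph) (G : groupType) (c : Gm -> G) (hc : coxsys c).
Let hp : psys c := proj1 hc.
Local Notation N := (sep hc).
Local Notation chi := (chi hc).

Lemma out_N n x g : out hc n g -> ~~ N g (c x) -> out hc n.+1 (c x * g).
Proof.
move=> og; rewrite -sign_sep => gx; apply: outS => //.
by have := @coord_neq0 _ _ _ hc g x; lia.
Qed.

Lemma outV n x g : out hc n g -> N g (c x) -> exists2 m, n = m.+1 & out hc m (c x * g).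
Proof. by move=> og; rewrite -sign_sep => gx; apply: out_neg => //; lia. Qed.

Lemma cox_ind (P : G -> Prop) : P 1 ->
  (forall x g, ~~ N g (c x) -> P g -> P (c x * g)) -> forall g, P g.
Proof.
move=> P1 PS g; have [n] := out_all hc g; elim=> {n g} // n x g _ Pg gx.
by apply: PS => //; rewrite -sign_sep; lia.
Qed.

Lemma sep_cM x g : N (c x * g) (c x) = ~~ N g (c x).
Proof. by rewrite sepM sepc eqxx (conjc_comm (commute_refl _)). Qed.

Lemma neq1_desc g : g <> 1 -> exists x, N g (c x).
Proof.
elim/cox_ind: g => // x g gx _ _; exists x.
by rewrite sep_cM.
Qed.

Lemma out_word w : exists2 n, (n <= size w)%nat & out hc n (cev c w).
Proof.
elim: w => [|x w [n nw on]]; first by exists 0%nat; rewrite ?cev_nil //; exact: out0.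
rewrite cev_cons; case: (boolP (N (cev c w) (c x))) => wx.
  by have [m mE om] := outV on wx; exists m => //=; lia.
by exists n.+1 => //; exact: out_N.
Qed.

Lemma word_out n g : out hc n g -> exists2 w, size w = n & cev c w = g.
Proof.
elim=> {n g} [|n x g _ [w wn wg] _]; first by exists [::]; rewrite ?cev_nil.
by exists (x :: w) => /=; rewrite ?wn // cev_cons wg.
Qed.

Lemma cev_rev w : cev c (rev w) = (cev c w)^-1.
Proof.
elim: w => [|x w IH]; first by rewrite cev_nil invg1.
by rewrite rev_cons -cats1 cev_cat cev1 IH cev_cons invgM (cinv hc).
Qed.

Lemma out_inv n g : out hc n g -> exists2 m, (m <= n)%nat & out hc m g^-1.
Proof.
by move=> /word_out[w <- <-]; have := out_word (rev w); rewrite size_rev cev_rev.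
Qed.

(** The standard parabolic subgroup of [U]. *)
Definition inP (U : set Gm) (g : G) : Prop :=
  exists2 w, all (fun y => `[< U y >]) w & cev c w = g.

Lemma inP1 U : inP U 1.
Proof. by exists [::]; rewrite ?cev_nil. Qed.

Lemma inPcM U x g : U x -> inP U g -> inP U (c x * g).
Proof.
by move=> Ux [w wU <-]; exists (x :: w); rewrite /= ?cev_cons // wU andbT asboolT.
Qed.

Lemma inP_ind U (P : G -> Prop) : P 1 ->
  (forall x g, U x -> inP U g -> P g -> P (c x * g)) -> forall g, inP U g -> P g.
Proof.
move=> P1 PS g [w + <-]; elim: w => [|x w IH] /=; first by rewrite cev_nil.
move=> /andP[/asboolP Ux wU]; rewrite cev_cons; apply: PS => //; first by exists w.
exact: IH.
Qed.

Lemma inP_N U u r : inP U u -> N u r -> exists v x, [/\ inP U v, U x & r = c x ^ v].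
Proof.
move=> uU; elim/inP_ind: u / uU r => [|x g Ux _ IH] r; first by rewrite sep1.
rewrite sepM sepc; case: eqP => [-> _|_ /= /IH[v [y [vU Uy rE]]]].
  by exists 1, x; rewrite conjg1; split=> //; exact: inP1.
case: vU rE => w wU <- rE.
exists (cev c w * c x), y; split=> //.
  exists (rcons w x); first by rewrite all_rcons wU andbT asboolT.
  by rewrite -cats1 cev_cat cev1.
by rewrite conjgM -rE (conjcc hc).
Qed.

Lemma inP_desc U u t : inP U u -> N u (c t) -> U t.
Proof.
by move=> uU /(inP_N uU)[v [x [_ Ux tE]]]; rewrite -(cJ_inj hc (esym tE)).
Qed.

Lemma inP_chi U u t : inP U u -> chi t u -> U t.
Proof.
move=> uU; elim/inP_ind: u / uU => [|x g Ux _ IH]; first by rewrite chi1.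
by rewrite chiM chic; case: asboolP => [<- //|_ /= /IH].
Qed.

Lemma weq_filter (p : pred Gm) u v :
  weq u v -> weq [seq x <- u | p x] [seq x <- v | p x].
Proof.
elim=> {u v} [w|u v _|v u w _ + _|u v x|u v x y xy].
- exact: weq_refl.
- exact: weq_sym.
- exact: weq_trans.
- by rewrite !filter_cat /=; case: (p x); [exact: weq_del | exact: weq_refl].
- rewrite !filter_cat /=; case: (p x); case: (p y); try exact: weq_refl.
  exact: weq_swap.
Qed.

(** Deleting the letters outside [U] respects [weq]: it fixes the word over [U] and turns the word
    over [V] into one over the intersection. *)
Lemma inP_inter U V g : inP U g -> inP V g -> inP (U `&` V) g.
Proof.
move=> [u uU <-] [v vV /(psys_eqP _ _ hp)]; set p := (fun y => `[<U y>]) in uU.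
move=> /(weq_filter p); rewrite (all_filterP uU) => vu.
exists [seq x <- v | p x]; last by apply/(psys_eqP _ _ hp).
elim: v vV {vu} => //= x v IH /andP[/asboolP Vx /IH]; rewrite /p.
by case: asboolP => //= Ux ->; rewrite andbT; apply/asboolP.
Qed.

(** Strip off a descent [x] of [z]. If [x] were outside the star of [s], then [s] would not be a
    descent of [z], so [x] and [s] would both be descents of [z * c s = c s * z], hence adjacent. *)
Lemma centralizer z s : commute z (c s) -> inP (star s) z.
Proof.
elim/cox_ind: z => [|x g gx IH] zs; first exact: inP1.
have zx : N (c x * g) (c x) by rewrite sep_cM.
have [xs|/not_orP[xs nsx]] := pselect (star s x).
  apply: inPcM => //; apply: IH.
  have cxs : commute (c x) (c s).
    by case: xs => [->|/(psysC hp)/commute_sym //]; exact: commute_refl.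
  apply: (mulgI (c x)); rewrite mulgA zs !mulgA cxs //.
have zs0 : ~~ N (c x * g) (c s).
  by apply/negP => /sep_desc/(_ zx (fun h => xs (esym h)))/nsx.
suff : adj x s by move=> /adj_sym/nsx.
apply: (@sep_desc _ _ _ hc (c x * g * c s)) => //.
  rewrite sepM zx sepc /=; apply/negP => /eqP /(cJ_inj hc) //.
by rewrite zs sep_cM.
Qed.

Lemma star_commute s u : inP (star s) u -> commute u (c s).
Proof.
elim/inP_ind=> [|x g [->|sx] _ IH]; apply/commute_sym.
- exact: commute1.
- by apply: commuteM; [exact: commute_refl | exact: commute_sym].
- by apply: commuteM; [exact: psysC | exact: commute_sym].
Qed.

Hypothesis tf : triangle_free Gm.

Lemma adj_neq x y : @adj Gm x y -> x <> y.
Proof. by move=> + xy; rewrite xy; exact: adj_irr. Qed.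

(** As for [centralizer]: a descent of [z] other than [a] and [b] would be adjacent to both, closing
    a triangle. *)
Lemma centralizer_edge a b z : adj a b -> commute z (c a * c b) ->
  [\/ z = 1, z = c a, z = c b | z = c a * c b].
Proof.
move=> ab; have cab := psysC hp ab; have ba := adj_sym ab.
elim/cox_ind: z => [|x g gx IH] zab; first by constructor.
have zx : N (c x * g) (c x) by rewrite sep_cM.
have red : commute (c x) (c a * c b) -> commute g (c a * c b).
  by move=> h; apply: (mulgI (c x)); rewrite mulgA zab mulgA -h !mulgA.
have [xa|xa] := pselect (x = a).
  rewrite xa in red *; case: IH => [|->|->|->|->].
  - by apply: red; apply: commuteM => //; exact: commute_refl.
  - by rewrite mulg1; constructor.
  - by rewrite (cK hc); constructor.
  - by constructor.
  - by rewrite (cKg hc); constructor.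
have [xb|xb] := pselect (x = b).
  rewrite xb in red *; case: IH => [|->|->|->|->].
  - by apply: red; apply: commuteM; [exact: commute_sym | exact: commute_refl].
  - by rewrite mulg1; constructor.
  - by rewrite -cab; constructor.
  - by rewrite (cK hc); constructor.
  - by rewrite cab (cKg hc); constructor.
exfalso.
have zabx : N (c x * g * (c a * c b)) (c x).
  rewrite sepM zx sepM !sepc /=; case: eqP => [/(cJ_inj hc)//|_].
  by case: eqP => [|//]; rewrite -conjgM => /(cJ_inj hc).
have far y y' : (y = a /\ y' = b) \/ (y = b /\ y' = a) -> ~ adj x y -> False.
  move=> yy' nxy.
  have [yx yab] : y <> x /\ adj y y' by case: yy' => [[-> ->]|[-> ->]]; split=> // /esym.
  have zy : ~~ N (c x * g) (c y).
    by apply/negP => /(sep_desc zx)/(_ (fun h => yx (esym h))).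
  apply: nxy; apply: (sep_desc zabx) => [|/esym //].
  rewrite zab (_ : c a * c b = c y * c y').
    rewrite -mulgA sep_cM sepM sepc conjc_comm; last exact: commute_sym (psysC hp (adj_sym yab)).
    by rewrite (negbTE zy) addbF c_eqE //; apply/negP => /asboolP /(adj_neq yab).
  by case: yy' => [[-> ->]|[-> ->]].
have nxa : ~ ~ adj x a by move=> /(far a b); apply; left.
have nxb : ~ ~ adj x b by move=> /(far b a); apply; right.
by apply: (tf (x := x) (y := a) (z := b)); split=> //; apply: contrapT.
Qed.

(** By [involution_type], [Vtype] and [Etype] exhaust the involutions of a triangle-free system. *)
Definition Vtype (r : G) := exists g a, r = c a ^ g.
Definition Etype (r : G) := exists g a b, adj a b /\ r = (c a * c b) ^ g.

Lemma Vtype_conj r g : Vtype (r ^ g) -> Vtype r.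
Proof. by move=> [h [a rE]]; exists (h * g^-1), a; rewrite conjgM -rE conjgK. Qed.

Lemma Etype_conj r g : Etype (r ^ g) -> Etype r.
Proof.
move=> [h [a [b [ab rE]]]]; exists (h * g^-1), a, b; split=> //.
by rewrite conjgM -rE conjgK.
Qed.

(* A shortest conjugate [g] of an involution commutes with all its descents,
   and by triangle-freeness there are at most two of them. *)
Lemma involution_type g : g * g = 1 -> g <> 1 -> Vtype g \/ Etype g.
Proof.
have [n] := out_all hc g; elim/ltn_ind: n g => n IH g og g2 g1.
have gV : g^-1 = g by exact: mulg1_eq.
have [[x [gx ncx]]|allc] :=
    pselect (exists x, N g (c x) /\ ~ commute g (c x)).
  have [m mE om] := outV og gx.
  have [k km] := out_inv om; rewrite invgM gV (cinv hc) => ok.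
  have gxx : N (g * c x) (c x).
    rewrite sepM gx sepc /=; apply/negP => /eqP h; apply: ncx.
    by rewrite /commute -{1}h conjgE !mulgA mulgV mul1g.
  have [l lE ol] := outV ok gxx.
  have gE : c x * (g * c x) = g ^ c x by rewrite conjgE (cinv hc).
  rewrite gE in ol; case: (IH l _ (g ^ c x)) => //.
  - lia.
  - by rewrite -conjMg g2 conj1g.
  - by move=> /eqP; rewrite conjg_eq1 => /eqP.
  - by move=> /Vtype_conj; left.
  - by move=> /Etype_conj; right.
have cN x : N g (c x) -> commute g (c x).
  by move=> gx; apply: contrapT => nc; apply: allc; exists x.
have [s gs] := neq1_desc g1; have cs := cN _ gs.
pose u := c s * g.
have us : ~~ N u (c s) by rewrite sep_cM negbK.
have uC : commute u (c s).
  by apply: commute_sym; apply: commuteM; [exact: commute_refl | exact: commute_sym].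
have gE : g = c s * u by rewrite /u (cKg hc).
have [u1|u1] := pselect (u = 1); first by left; exists 1, s; rewrite conjg1 gE u1 mulg1.
have [t ut] := neq1_desc u1.
have st : adj s t.
  by case: (inP_desc (centralizer uC) ut) => // ts; rewrite ts (negbTE us) in ut.
have cst := psysC hp st.
have gt : N g (c t).
  rewrite gE sepM sepc conjc_comm ?ut; last exact: commute_sym.
  by rewrite addbT c_eqE //; apply/negP => /asboolP /(adj_neq (adj_sym st)).
have ct := cN _ gt.
pose v := c t * u.
have vt : ~~ N v (c t) by rewrite sep_cM negbK.
have uCt : commute u (c t).
  apply: commute_sym; apply: commuteM; [exact: commute_sym | exact: commute_sym].
have vCt : commute v (c t).
  by apply: commute_sym; apply: commuteM; [exact: commute_refl | exact: commute_sym].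
have vCs : commute v (c s).
  by apply: commute_sym; apply: commuteM; exact: commute_sym.
have vs : ~~ N v (c s).
  rewrite /v sepM sepc conjc_comm // (negbTE us) addbF c_eqE //.
  by apply/negP => /asboolP /(adj_neq st).
have [v1|v1] := pselect (v = 1).
  right; exists 1, s, t; split=> //; rewrite conjg1 gE; congr (_ * _).
  by apply: (mulgI (c t)); rewrite (cK hc) -v1.
have [x vx] := neq1_desc v1; exfalso.
have [xE|sx] := inP_desc (centralizer vCs) vx.
  by rewrite xE (negbTE vs) in vx.
have [xE|tx] := inP_desc (centralizer vCt) vx.
  by rewrite xE (negbTE vt) in vx.
by apply: (tf (x := s) (y := t) (z := x)); split.
Qed.

(** The centralizer of [p] has at most four elements. No basis is mentioned, so this can be compared
    between two bases: elements of [Etype] are small, those of [Vtype] are not once every vertex has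
    two neighbours. *)
Definition small (p : G) : Prop := exists q, forall z, commute z p ->
  [\/ z = 1, z = p, z = q | z = p * q].

Lemma Etype_small r : Etype r -> small r.
Proof.
move=> [g [a [b [ab rE]]]]; exists (c a ^ g) => z zr.
have : commute (z ^ g^-1) (c a * c b).
  by apply/(conj_commute _ _ g); rewrite conjgKV -rE.
move=> /(centralizer_edge ab)[] /(congr1 (conjg^~ g)); rewrite /= conjgKV => zE.
- by rewrite zE conj1g; constructor.
- by rewrite zE; constructor.
- rewrite zE rE -conjMg (psysC hp ab) (cgK hc); exact: Or44.
- by rewrite zE rE; constructor.
Qed.

(** Otherwise all three are conjugate to generators. After exchanging [q] with [p * q] if necessary,
    [q] has coordinate 0 at the generator [s] of [p]. Then [p * q] is conjugate to [c s] as well, so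
    [q] vanishes in the abelianization, which no non-trivial involution does. *)
Lemma commuting_Etype p q : commute p q -> p * p = 1 -> q * q = 1 ->
  p <> 1 -> q <> 1 -> p <> q -> [\/ Etype p, Etype q | Etype (p * q)].
Proof.
move=> cpq p2 q2 p1 q1 pq.
have pq2 : p * q * (p * q) = 1 by rewrite mulgA -(mulgA p q p) -cpq mulgA p2 mul1g.
have pq1 : p * q <> 1.
  by move=> h; apply: pq; apply: (mulIg q); rewrite h q2.
case: (involution_type p2 p1) => [|Ep]; last by constructor.
move=> [g [s pE]].
have chip y : chi y p = `[<s = y>] by rewrite pE chiJ chic.
wlog qs : q cpq q1 q2 pq pq2 pq1 / chi s q = false.
  move=> W; case qs: (chi s q); last exact: W.
  have ppq : p * (p * q) = q by rewrite mulgA p2 mul1g.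
  case: (W (p * q)) => //.
  - exact: commuteM (commute_refl _) cpq.
  - by move=> h; apply: q1; apply: (mulgI p); rewrite -h mulg1.
  - by rewrite ppq.
  - by rewrite ppq.
  - by rewrite chiM qs chip asboolT.
  - by constructor.
  - by move=> ?; apply: Or33.
  - by rewrite ppq => ?; apply: Or32.
case: (involution_type pq2 pq1) => [[h [x xE]]|]; last by exact: Or33.
have xs : x = s.
  apply/asboolP; have := congr1 (chi s) xE.
  by rewrite chiM chip qs chiJ chic (asboolT (erefl s)) => <-.
have q0 y : chi y q = false.
  have := congr1 (chi y) xE; rewrite chiM chip chiJ chic xs.
  by case: `[<_>]; case: (chi y q).
case: (involution_type q2 q1) => [[k [y yE]]|[k [y [z [yz yE]]]]].
  by have := q0 y; rewrite yE chiJ chic asboolT.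
have := q0 y; rewrite yE chiJ chiM !chic asboolT // asboolF //.
by move=> zy; apply: (adj_neq yz).
Qed.

(** The product is then conjugate to some [c a * c b], and [centralizer_edge] leaves only the two
    factors for [p]. *)
Lemma commuting_edge p q : commute p q -> p * p = 1 -> q * q = 1 ->
  p <> 1 -> q <> 1 -> p <> q -> ~ Etype p -> ~ Etype q ->
  exists g a b, [/\ adj a b, p = c a ^ g & q = c b ^ g].
Proof.
move=> cpq p2 q2 p1 q1 pq nEp nEq.
case: (commuting_Etype cpq p2 q2 p1 q1 pq) => // [[g [a [b [ab pqE]]]]].
have qE : q = p * (p * q) by rewrite mulgA p2 mul1g.
have : commute (p ^ g^-1) (c a * c b).
  apply/(conj_commute _ _ g); rewrite conjgKV -pqE.
  exact: commuteM (commute_refl _) cpq.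
move=> /(centralizer_edge ab)[] /(congr1 (conjg^~ g)); rewrite /= conjgKV => pE.
- by case: p1; rewrite pE conj1g.
- exists g, a, b; split=> //.
  by rewrite qE {1}pE pqE -conjMg (cKg hc).
- exists g, b, a; split=> //; first exact: adj_sym.
  by rewrite qE {1}pE pqE -conjMg (psysC hp ab) (cKg hc).
- by case: q1; apply: (mulgI p); rewrite mulg1 pqE -pE.
Qed.

(** One of the three involutions of this four-group is of [Etype], hence has a centralizer of at
    most four elements. This excludes triangles in a second basis. *)
Lemma commuting_small (p q z : G) : commute p q -> p * p = 1 -> q * q = 1 ->
  p <> 1 -> q <> 1 -> p <> q -> commute z p -> commute z q ->
  [\/ z = 1, z = p, z = q | z = p * q].
Proof.
move=> cpq p2 q2 p1 q1 pq zp zq.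
have zpq := commuteM zp zq.
have key r s : r * r = 1 -> commute s r -> s <> 1 -> s <> r -> Etype r ->
    commute z r -> [\/ z = 1, z = r, z = s | z = r * s].
  move=> r2 sr s1 sNr /Etype_small[t tP] zr.
  case: (tP _ sr) => // sE; first by rewrite sE; exact: tP.
  have -> : s = r * t by [].
  by rewrite mulgA r2 mul1g; case: (tP _ zr) => ->; [exact: Or41|exact: Or42|exact: Or44|exact: Or43].
case: (commuting_Etype cpq p2 q2 p1 q1 pq) => E.
- by case: (key p q) => // [/esym //|->|->|->|->]; [exact: Or41|exact: Or42|exact: Or43|exact: Or44].
- by case: (key q p) => // [->|->|->|->]; rewrite -?cpq; [exact: Or41|exact: Or43|exact: Or42|exact: Or44].
- case: (key (p * q) p) => // [|||->|->|->|->].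
  + by rewrite mulgA -(mulgA p q p) -cpq mulgA p2 mul1g.
  + exact: commuteM (commute_refl _) cpq.
  + by move=> h; apply: q1; apply: (mulgI p); rewrite -h mulg1.
  + exact: Or41.
  + exact: Or44.
  + exact: Or42.
  + by rewrite cpq -mulgA p2 mulg1; exact: Or43.
Qed.

(** Two neighbours of [s] give two elements commuting with [r]. Smallness would make each of them
    [q] or [r * q], and the coordinate at [s] forbids that they differ by the factor [r]. *)
Lemma Vtype_not_small r : (forall s : Gm, exists x y, [/\ x <> y, adj s x & adj s y]) ->
  Vtype r -> ~ small r.
Proof.
move=> deg2 [g [s rE]] [q qP].
have [x [y [xy sx sy]]] := deg2 s.
have cm z : adj s z -> commute (c z ^ g) r.
  by move=> sz; rewrite rE; apply/conj_commute; exact: psysC (adj_sym sz).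
have r2 : r * r = 1 by rewrite rE -conjMg (cK hc) conj1g.
have qE z : adj s z -> c z ^ g = q \/ c z ^ g = r * q.
  move=> sz; case: (qP _ (cm _ sz)) => zE; [| |by left|by right].
    by have := @c_neq1 _ _ _ hc z; case; apply: (@conjg_inj _ g); rewrite zE conj1g.
  have := zE; rewrite rE => /conjg_inj/(c_inj hc) zs.
  by have := adj_neq sz; rewrite zs.
have no u v : adj s u -> adj s v -> c u ^ g <> r * c v ^ g.
  move=> su sv /(congr1 (chi s)); rewrite rE chiM !chiJ !chic (asboolT (erefl s)).
  by rewrite !asboolF // => h; [have := adj_neq sv|have := adj_neq su]; rewrite h.
case: (qE x sx) (qE y sy) => [xq|xq] [yq|yq].
- by apply: xy; apply: (c_inj hc); apply: (@conjg_inj _ g); rewrite xq yq.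
- by apply: (no y x sy sx); rewrite yq xq.
- by apply: (no x y sx sy); rewrite yq xq.
- by apply: xy; apply: (c_inj hc); apply: (@conjg_inj _ g); rewrite xq yq.
Qed.

End Centralizers.

(** * Rigidity *)

Lemma connected_ind (Gm : graph) (P : Gm -> Prop) (x y : Gm) :
  connected_graph Gm -> (forall u v, adj u v -> P u -> P v) -> P x -> P y.
Proof.
move=> /(_ x y) + PS; elim=> {x y} [x y /PS //|//|x y z _ IH1 _ IH2 /IH1/IH2//].
Qed.

Lemma K0'_edge (Gm : graph) : K0' Gm -> exists a b : Gm, adj a b.
Proof.
move=> [_ _ _ [f [_ fE]]]; exists (f ord0), (f (ordS ord0)).
by apply/fE; rewrite /C4_adj eqxx.
Qed.

Lemma K0'_deg2 (Gm : graph) : K0' Gm ->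
  forall s : Gm, exists x y, [/\ x <> y, adj s x & adj s y].
Proof.
move=> [sp sc tf [f [fI fE]]] s.
have [x sx] : exists x, adj s x.
  apply: contrapT => /forallNP ns.
  pose i0 : 'I_4 := ord0; pose i1 := ordS i0; pose i2 := ordS i1.
  have f01 : adj (f i0) (f i1) by apply/fE.
  have f12 : adj (f i1) (f i2) by apply/fE.
  have s0 : (~` star (f i0)) s.
    move=> [sE|/adj_sym/ns//]; apply: (ns (f i1)); by rewrite sE.
  have f20 : (~` star (f i0)) (f i2) by move=> [/fI|/fE].
  (* An isolated [s] is a whole component of the complement of the star of [f i0]; this complement
     is connected and contains the opposite corner [f i2]. *)
  have sE := @connected_ind (induced (~` star (f i0))) (fun u => val u = s) (exist _ s (mem_set s0))
    (exist _ (f i2) (mem_set f20)) (sc (f i0)).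
  have /= f2s : f i2 = s by apply: sE => // u v uv us; case: (ns (val v)); rewrite -us.
  by apply: (ns (f i1)); rewrite -f2s; exact: adj_sym.
have sNx : s <> x by move=> sE; apply: (@adj_irr Gm s); rewrite {2}sE.
(* If [x] were the only neighbour of [s], the star of [s] would lie in the star of [x]. *)
have [y [ys ynx]] : exists y, star s y /\ ~ star x y.
  apply: contrapT => /forallNP h; apply: (sp s x sNx) => y ys.
  by apply: contrapT => yx; apply: (h y).
exists x, y; split=> //.
  by move=> xy; apply: ynx; left.
case: ys => // ys; case: ynx; right; rewrite ys; exact: adj_sym.
Qed.

Section Orientation.
Variables (Gm Dm : graph) (G : groupType) (c : Gm -> G) (d : Dm -> G).
Hypotheses (hc : coxsys c) (hd : coxsys d).
Local Notation N := (sep hc).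

Lemma sep_commuting a v q : commute q (c a ^ v) -> q <> c a ^ v -> N (c a ^ v) q = false.
Proof.
move=> qa qNa; have qa' : commute (q ^ v^-1) (c a).
  by apply/(conj_commute _ _ v); rewrite conjgKV.
rewrite conjgE !sepM sepV sepc (conjg_commute qa'); case: eqP => [h|_].
  by case: qNa; rewrite -h conjgKV.
by rewrite /= addbb.
Qed.

(* The wall of a reflection not commuting with [r] lies on one side of the
   wall of [r], so that side can be read off at any chamber along it. *)
Lemma side_eq a v v' r : c a ^ v = c a ^ v' -> ~ commute r (c a ^ v) ->
  N v^-1 r = N v'^-1 r.
Proof.
move=> vv' nc; pose z := v * v'^-1.
have za : commute z (c a).
  apply: commute_sym; rewrite /commute -[RHS](mulgA v) conjgC /z.
  by rewrite mulgA; congr (_ * _); rewrite conjgM vv' conjgK.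
have -> : v'^-1 = v^-1 * z by rewrite /z mulKg.
rewrite sepM; case zr: (N z _); last by rewrite addbF.
have [u [x [uP xP rE]]] := inP_N (centralizer hc za) zr.
case: nc; apply/(conj_commute _ _ v^-1); rewrite conjgK rE.
have ua := star_commute hc uP.
rewrite -(conjg_commute (commute_sym ua)); apply/conj_commute.
by case: xP => [->|ax]; [exact: commute_refl | exact: commute_sym (psysC (proj1 hc) ax)].
Qed.

(* If the walls of the reflections [d t] face each other pairwise and [1] is
   on the inner side of all of them, the chamber [1] is a fundamental domain
   for the group they generate, hence [c] and [d] have the same range. *)
Lemma facing_range :
  (forall t, exists v a, d t = c a ^ v) ->
  (forall t x v a, d x = c a ^ v -> x <> t -> ~ adj t x -> N v^-1 (d t) = false) ->
  (forall s, exists t, d t = c s) /\ (forall t, exists s, d t = c s).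
Proof.
move=> dV H.
(* No chamber is beyond two facing walls: when a gallery from [1] crosses one of them, it reaches a
   chamber along that wall, which is on the near side of the other. *)
have nest t t' g : t <> t' -> ~ adj t t' -> N g (d t) -> N g (d t') -> False.
  move=> tt' ntt'; elim/(cwordr_ind hc): g => [|x g IH]; first by rewrite sep1.
  have ntt'' : ~ adj t' t by move=> /adj_sym.
  have cross u u' : u <> u' -> ~ adj u u' -> d u ^ g = c x -> N (g * c x) (d u') = false.
    move=> uu' nuu' ux; have uE : d u = c x ^ g^-1 by rewrite -ux conjgK.
    rewrite sepM sepc; case: eqP => [u'x|_].
      by case: uu'; apply: (c_inj hd); apply: (@conjg_inj _ g); rewrite ux u'x.
    rewrite addbF -[g]invgK; apply: H uE uu' _ => /adj_sym //.
  move=> gt gt'; have [h|h] := eqVneq (d t ^ g) (c x).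
    by rewrite (cross _ _ tt' ntt' h) in gt'.
  have [h'|h'] := eqVneq (d t' ^ g) (c x).
    by rewrite (cross _ _ (fun e => tt' (esym e)) ntt'' h') in gt.
  apply: IH; first by move: gt; rewrite sepM sepc (negbTE h) addbF.
  by move: gt'; rewrite sepM sepc (negbTE h') addbF.
(* The sides measured by [c] agree with those measured by [d]. When a letter [x] far from [t] is
   added, both are false: the left one by [nest], the right one by [sep_desc]. *)
have NN g t : N g (d t) = sep hd g (d t).
  elim/(@cox_ind _ _ _ hd): g t => [|x g gx IH] t; first by rewrite !sep1.
  have gxx : N (d x * g) (d x).
    rewrite sepM (conjg_commute (commute_refl _)) IH (negbTE gx) addbF.
    by have [v [a ->]] := dV x; exact: sep_self.
  have [->|tx] := pselect (t = x); first by rewrite gxx sep_cM.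
  have [xt|xt] := pselect (adj x t).
    have cxt := psysC (proj1 hd) xt.
    rewrite !sepM !(conjg_commute (commute_sym cxt)) IH; congr (_ (+) _).
    rewrite sepc (c_eqE hd) (asboolF tx).
    have [v [a aE]] := dV x; rewrite aE; apply: sep_commuting.
      by rewrite -aE; exact: commute_sym.
    by rewrite -aE => /(c_inj hd).
  rewrite [RHS](_ : _ = false).
    by apply/negP => /(nest _ _ _ (fun h => tx (esym h)) xt gxx).
  apply/negP => /sep_desc-/(_ x); rewrite sep_cM => /(_ gx tx)/adj_sym //.
(* A descent [t] of [c s] with respect to [d] is a wall between [1] and [c s], and the wall of [c s]
   is the only one. *)
have S1 s : exists t, d t = c s.
  have [t] := neq1_desc hd (@c_neq1 _ _ _ hc s).
  by rewrite -NN sepc => /eqP; exists t.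
split=> // t; have [v [a tE]] := dV t; have [t' t'E] := S1 a; exists a.
by rewrite -t'E; congr d; apply/esym/(cJ_inj hd (g := v)); rewrite t'E.
Qed.

End Orientation.

Section Rigidity.
Variables (Gm Dm : graph) (G : groupType) (c : Gm -> G) (d : Dm -> G).
Hypotheses (hc : coxsys c) (hd : coxsys d) (KG : K0' Gm).
Local Notation N := (sep hc).

Let tf : triangle_free Gm. Proof. by case: KG. Qed.
Let sc : star_connected Gm. Proof. by case: KG. Qed.
Let deg2 := K0'_deg2 KG.

Let d2 t : d t * d t = 1. Proof. exact: (psysV (proj1 hd)). Qed.
Let dN1 t : d t <> 1. Proof. exact: c_neq1. Qed.
Let dadj t t' : adj t t' -> commute (d t) (d t'). Proof. exact: (psysC (proj1 hd)). Qed.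
Let dneq t t' : adj t t' -> d t <> d t'.
Proof. by move=> tt' /(c_inj hd); exact: adj_neq. Qed.

(** The third vertex of a triangle would centralize the four-group of the other two without lying in
    it. *)
Lemma rigid_tf : triangle_free Dm.
Proof.
move=> x y z [xy yz xz].
have := commuting_small hc tf (dadj xy) (d2 x) (d2 y) (@dN1 x) (@dN1 y) (dneq xy)
  (commute_sym (dadj xz)) (commute_sym (dadj yz)).
case; [exact: dN1| | |].
- exact/nesym/dneq.
- exact/nesym/dneq.
move=> /(congr1 (chi hd z)); rewrite chiM !chic (asboolT (erefl z)).
by rewrite !asboolF // => h; [have := adj_neq yz|have := adj_neq xz]; rewrite h.
Qed.

(** An element of [Etype] for [d] is small, and [r] is not. *)
Lemma Vtype_transfer r : Vtype c r -> Vtype d r.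
Proof.
move=> rV; have nsm := Vtype_not_small hc deg2 rV.
have [g [a rE]] := rV.
case: (involution_type hd rigid_tf (g := r)) => //.
- by rewrite rE -conjMg (cK hc) conj1g.
- move=> r1; apply: (@c_neq1 _ _ _ hc a); apply: (@conjg_inj _ g).
  by rewrite conj1g -rE.
- by move=> /(Etype_small hd rigid_tf)/nsm.
Qed.

(** If [d t] were of [Etype] for [c], its two factors would be conjugate to generators [d u] and
    [d v], so that [t] would be the sum of [u] and [v] in the abelianization. *)
Lemma rigid_Vtype t : Vtype c (d t).
Proof.
case: (involution_type hc tf (d2 t)) => [|//|[g [a [b [ab tE]]]]]; first exact: dN1.
have V x : Vtype d (c x ^ g) by apply: Vtype_transfer; exists g, x.
have [h [u uE]] := V a; have [k [v vE]] := V b.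
have H y : `[<t = y>] = `[<u = y>] (+) `[<v = y>].
  have := congr1 (chi hd y) tE; rewrite conjMg uE vE chiM !chiJ.
  by rewrite !chic.
exfalso; have [uv|uv] := pselect (u = v).
  by have := H t; rewrite uv asboolT // addbb.
have := H u; rewrite (asboolT (erefl u)) (asboolF (fun h => uv (esym h))) => /asboolP tu.
have := H v; rewrite (asboolT (erefl v)) (asboolF uv) => /asboolP tv.
by apply: uv; rewrite -tu -tv.
Qed.

Lemma Vtype_nE r : Vtype c r -> ~ Etype c r.
Proof. by move=> /(Vtype_not_small hc deg2) h /(Etype_small hc tf). Qed.

Lemma Vtype_nEd r : Vtype c r -> ~ Etype d r.
Proof. by move=> /(Vtype_not_small hc deg2) h /(Etype_small hd rigid_tf). Qed.

Lemma rigid_edge t t' : adj t t' ->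
  exists g a b, [/\ adj a b, d t = c a ^ g & d t' = c b ^ g].
Proof.
move=> tt'; apply: (commuting_edge hc tf) (dadj tt') (d2 t) (d2 t') _ _ (dneq tt') _ _.
- exact: dN1.
- exact: dN1.
- exact/Vtype_nE/rigid_Vtype.
- exact/Vtype_nE/rigid_Vtype.
Qed.

Lemma rigid_edgeV a b : adj a b ->
  exists g t t', [/\ adj t t', d t = c a ^ g & d t' = c b ^ g].
Proof.
move=> ab; have [|||||g [t [t' [tt' aE bE]]]] := commuting_edge hd rigid_tf
    (psysC (proj1 hc) ab) (cK hc a) (cK hc b).
- exact: c_neq1.
- exact: c_neq1.
- by move=> /(c_inj hc); exact: adj_neq.
- by apply: Vtype_nEd; exists 1, a; rewrite conjg1.
- by apply: Vtype_nEd; exists 1, b; rewrite conjg1.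
exists g^-1, t, t'; split=> //; by rewrite (aE, bE) conjgK.
Qed.

Lemma rigid_noncomm t x a b v w : d t = c b ^ w -> d x = c a ^ v ->
  ~ star b a -> ~ commute (d t) (d x).
Proof.
move=> tE xE nba ctx; have [tx|tx] := pselect (t = x).
  apply: nba; left; apply: (@cJ_inj _ _ _ hc _ _ (v * w^-1)).
  by rewrite conjgM -xE -tx tE conjgK.
have [g [a' [b' [ab' tE' xE']]]] := rigid_edge (adj_commute hd tx ctx).
apply: nba; right.
have -> : b = a'.
  by apply: (@cJ_inj _ _ _ hc _ _ (w * g^-1)); rewrite conjgM -tE tE' conjgK.
have -> // : a = b'.
by apply: (@cJ_inj _ _ _ hc _ _ (v * g^-1)); rewrite conjgM -xE xE' conjgK.
Qed.

Lemma rigid_star t x a b v w : d t = c b ^ w -> d x = c a ^ v ->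
  x <> t -> ~ adj t x -> ~ star b a.
Proof.
move=> tE xE xt ntx [ab|ba].
  apply: xt; apply: (@cJ_inj _ _ _ hd _ _ (v^-1 * w)).
  by rewrite conjgM xE conjgK ab -tE.
have [g [t' [x' [tx' tE' xE']]]] := rigid_edgeV ba; apply: ntx.
have -> : t = t'.
  by apply: (@cJ_inj _ _ _ hd _ _ (w^-1 * g)); rewrite conjgM tE conjgK -tE'.
have -> // : x = x'.
by apply: (@cJ_inj _ _ _ hd _ _ (v^-1 * g)); rewrite conjgM xE conjgK -xE'.
Qed.

(* Adjacent walls avoiding the wall of [t] lie on the same side of it, so
   star-connectedness puts all of them on the same side. *)
Lemma rigid_side t : exists s : bool, forall x v a, d x = c a ^ v ->
  x <> t -> ~ adj t x -> N v^-1 (d t) = s.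
Proof.
have [w [b tE]] := rigid_Vtype t.
have [[x0 [x0t nx0]]|no] := pselect (exists x0, x0 <> t /\ ~ adj t x0); last first.
  by exists true => x v a _ xt ntx; case: no; exists x.
have [v0 [a0 x0E]] := rigid_Vtype x0; exists (N v0^-1 (d t)) => x v a xE xt ntx.
have ba0 := rigid_star tE x0E x0t nx0; have ba := rigid_star tE xE xt ntx.
pose P (u : induced (~` star b)) := forall y k, d y = c (val u) ^ k ->
  N k^-1 (d t) = N v0^-1 (d t).
have side y y' u k k' : ~ star b u -> d y = c u ^ k -> d y' = c u ^ k' ->
    N k^-1 (d t) = N k'^-1 (d t).
  move=> bu yE y'E.
  have yy' : y = y'.
    by apply: (@cJ_inj _ _ _ hd _ _ (k^-1 * k')); rewrite conjgM yE conjgK -y'E.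
  apply: (@side_eq _ _ _ hc u); first by rewrite -yE -y'E yy'.
  by rewrite -yE; exact: rigid_noncomm tE yE bu.
suff Pa : P (exist _ a (mem_set ba)) by exact: Pa xE.
apply: (@connected_ind _ P (exist _ a0 (mem_set ba0)) _ (@sc b)).
  move=> u u' uu' Pu y k yE.
  have [g [t1 [t2 [t12 t1E t2E]]]] := rigid_edgeV uu'.
  rewrite -(Pu _ _ t1E); apply: side yE t2E.
  by have := valP u'; rewrite inE.
move=> y k yE; apply: side yE x0E.
exact: ba0.
Qed.

Lemma rigidity : exists g (phi : Dm -> Gm),
  (forall t, d t = c (phi t) ^ g) /\ (forall s, exists t, phi t = s).
Proof.
have [s sP] := choice rigid_side.
have [a [b ab]] := K0'_edge KG.
have [g0 [t0 [t1 [t01 t0E t1E]]]] := rigid_edgeV ab.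
(* [g0] may be multiplied by [c a] and by [c b] independently; the four chambers so obtained realize
   all choices of sides of the two crossing walls. *)
have [g [gt0 gt1 gs0 gs1]] : exists g, [/\ d t0 = c a ^ g, d t1 = c b ^ g,
    N g^-1 (d t0) = s t0 & N g^-1 (d t1) = s t1].
  have cab := psysC (proj1 hc) ab.
  have ba : (c b == c a) = false.
    by rewrite (c_eqE hc) asboolF // => /esym; exact: adj_neq.
  have [g1 [g1t0 g1t1 g1s0]] : exists g, [/\ d t0 = c a ^ g, d t1 = c b ^ g
      & N g^-1 (d t0) = s t0].
    have [e|/eqP ne] := eqVneq (N g0^-1 (d t0)) (s t0); first by exists g0.
    exists (c a * g0); split.
    - by rewrite conjgM (conjg_commute (commute_refl _)).
    - by rewrite conjgM (conjg_commute (commute_sym cab)).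
    - rewrite invgM sepM t0E conjgK (cinv hc) sepc eqxx -t0E.
      by move: ne; case: (N _ _); case: (s t0).
  have [e|/eqP ne] := eqVneq (N g1^-1 (d t1)) (s t1); first by exists g1.
  exists (c b * g1); split.
  - by rewrite conjgM (conjg_commute cab).
  - by rewrite conjgM (conjg_commute (commute_refl _)).
  - by rewrite -g1s0 invgM sepM g1t0 conjgK (cinv hc) sepc eq_sym ba addbF.
  - rewrite invgM sepM g1t1 conjgK (cinv hc) sepc eqxx -g1t1.
    by move: ne; case: (N _ _); case: (s t1).
(* By triangle-freeness any other [t] is non-adjacent to [t0] or to [t1], and the chamber [g^-1]
   lies along the walls of both. *)
have gs t : N g^-1 (d t) = s t.
  have [->//|tt0] := pselect (t = t0).
  have [->//|tt1] := pselect (t = t1).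
  have [tn|nn] := pselect (adj t t0); last exact: sP gt0 (fun h => tt0 (esym h)) nn.
  apply: sP gt1 (fun h => tt1 (esym h)) _ => tn1.
  by apply: (rigid_tf (x := t) (y := t0) (z := t1)); split.
(* Conjugating by [g^-1] moves the chamber [g^-1] to [1], as [facing_range] requires. *)
pose d' t := d t ^ g^-1.
have hd' : coxsys d'.
  exact: (coxsys_morph hd (conjg_morph g^-1) (conjg_bij g^-1)).
have [|t x v u xE xt ntx|S1 S2] := @facing_range _ _ _ c d' hc hd'.
- move=> t; have [v [u tE]] := rigid_Vtype t; exists (v * g^-1), u.
  by rewrite /d' tE conjgM.
- have xE' : d x = c u ^ (v * g) by rewrite conjgM -xE conjgKV.
  have := sP t _ _ _ xE' xt ntx; rewrite -gs.
  by rewrite invgM sepM /d'; case: (N g^-1 _); case: (N v^-1 _).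
have [phi phiP] := choice S2; exists g, phi; split=> [t|z].
  by rewrite -phiP conjgKV.
have [t tE] := S1 z; exists t; apply: (c_inj hc).
by rewrite -phiP tE.
Qed.

End Rigidity.

(** * Squares of infinite sets *)

Definition inj_into (T U : Type) (A : set T) (B : set U) (f : T -> U) : Prop :=
  (forall x, A x -> B (f x)) /\
  (forall x y, A x -> A y -> f x = f y -> x = y).

Lemma chain_pair (T : Type) (F : set (set T)) (x y : T) : total_on F subset ->
  (\bigcup_(X in F) X) x -> (\bigcup_(X in F) X) y -> exists X, [/\ F X, X x & X y].
Proof.
move=> Ftot [X FX Xx] [Y FY Yy].
by have [XY|YX] := Ftot X Y FX FY; [exists Y | exists X]; split=> //; [exact: XY|exact: YX].
Qed.

(** A maximal partial bijection, given as a set of pairs, is defined on all of [A] or hits all of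
    [B]. *)
Lemma comparable_sets (T : Type) (A B : set T) :
  (exists f, inj_into A B f) \/ (exists f, inj_into B A f).
Proof.
pose P (R : set (T * T)) := (forall p, R p -> A p.1 /\ B p.2) /\
  (forall p q, R p -> R q -> p.1 = q.1 <-> p.2 = q.2).
have [F FP Ftot|R [[RAB Rinj] Rmax]] := @Zorn_bigcup _ P.
  split=> [p [X /FP[XAB _] /XAB //]|p q Fp Fq].
  have [X [/FP[_ Xinj] Xp Xq]] := chain_pair Ftot Fp Fq.
  exact: Xinj.
have [dA|/existsNP[a /not_implyP[Aa na]]] := pselect (forall x, A x -> exists y, R (x, y)).
  left; pose f x := if pselect (exists y, R (x, y)) is left h then sval (cid h) else x.
  have fR x : A x -> R (x, f x).
    by move=> /dA xy; rewrite /f; case: pselect => // h; case: cid.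
  exists f; split=> [x /fR/RAB[]//|x y Ax Ay fxy].
  by apply/(Rinj _ _ (fR _ Ax) (fR _ Ay)).
have [dB|/existsNP[b /not_implyP[Bb nb]]] := pselect (forall y, B y -> exists x, R (x, y)).
  right; pose f y := if pselect (exists x, R (x, y)) is left h then sval (cid h) else y.
  have fR y : B y -> R (f y, y).
    by move=> /dB xy; rewrite /f; case: pselect => // h; case: cid.
  exists f; split=> [y /fR/RAB[]//|x y Bx By fxy].
  by apply/(Rinj _ _ (fR _ Bx) (fR _ By)).
case: (Rmax (R `|` [set (a, b)])).
  split; first by left.
  by move=> /(_ (a, b) (or_intror erefl)) Rab; apply: na; exists b.
have na' y : ~ R (a, y) by move=> h; apply: na; exists y.
have nb' x : ~ R (x, b) by move=> h; apply: nb; exists x.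
split=> [p [/RAB //|-> //]|p q [Rp|->] [Rq|->]] //; first exact: Rinj.
- by case: p Rp => x y Rp /=; split=> e; [case: (na' y)|case: (nb' x)]; rewrite -e.
- by case: q Rq => x y Rq /=; split=> e; [case: (na' y)|case: (nb' x)]; rewrite e.
Qed.

Lemma infinite_sequence (L : Type) : infinite_set [set: L] ->
  exists i : nat -> L, injective i.
Proof.
move=> /infiniteP/card_leP[i].
exists (fun n => val (i (exist _ n (mem_set I)))) => m n /val_inj mn.
by have /(congr1 val) := @inj _ _ _ i _ _ (mem_set I) (mem_set I) mn.
Qed.

(** Zorn's lemma on sets [E] with an injective pairing of [E * E] into [E]. For a maximal [E],
    either the complement injects into [E], and two copies of [E] inside [E] absorb the whole type,
    or the complement contains a copy of [E], which gives room to extend the pairing. *)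
Lemma infinite_pairing (L : Type) : infinite_set [set: L] ->
  exists p : L * L -> L, injective p.
Proof.
move=> /infinite_sequence[i iI].
pose D (R : set (L * L * L)) := [set x | exists z, R ((x, x), z)].
pose good (R : set (L * L * L)) :=
  [/\ forall p q, R p -> R q -> p.1 = q.1 <-> p.2 = q.2,
      forall x y z, R ((x, y), z) -> [/\ D R x, D R y & D R z] &
      forall x y, D R x -> D R y -> exists z, R ((x, y), z)].
pose R0 : set (L * L * L) :=
  [set t | exists m n, t = ((i m, i n), i (pickle (m, n)))].
have D0 n : D R0 (i n) by exists (i (pickle (n, n))), n, n.
have D0E x : D R0 x -> exists n, x = i n by move=> [z [m [n [-> _ _]]]]; exists m.
have good0 : good R0.
  split=> [p q [m [n ->]] [m' [n' ->]] /=|x y z [m [n [-> -> ->]]]|x y].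
  - split=> [[/iI -> /iI -> //]|/iI/(pcan_inj pickleK)[-> ->] //].
  - by split; exact: D0.
  - by move=> /D0E[m ->] /D0E[n ->]; exists (i (pickle (m, n))), m, n.
(* Only the part added to [R0] varies, so that the empty chain has a [good] union too. *)
have [F FP Ftot|Rm [gR Rmax]] := @Zorn_bigcup _ [set R | good (R0 `|` R)].
  have [->|/set0P[X0 FX0]] := eqVneq F set0.
    by rewrite /= bigcup_set0 setU0.
  have FX p q : (R0 `|` \bigcup_(X in F) X) p -> (R0 `|` \bigcup_(X in F) X) q ->
      exists X, [/\ F X, (R0 `|` X) p & (R0 `|` X) q].
    move=> [p0|Fp] [q0|Fq].
    - by exists X0; split=> //; left.
    - by case: Fq => X FX Xq; exists X; split=> //; [left|right].
    - by case: Fp => X FX Xq; exists X; split=> //; [right|left].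
    - by have [X [? ? ?]] := chain_pair Ftot Fp Fq; exists X; split=> //; right.
  have up X p : F X -> (R0 `|` X) p -> (R0 `|` \bigcup_(X in F) X) p.
    by move=> FX' [|Xp]; [left|right; exists X].
  split=> [p q /FX h /h[X [/FP[Xi _ _]]]|x y z h|x y [z xz] [t yt]].
  - exact: Xi.
  - have [X [FX' Xp _]] := FX _ _ h h; have [_ XD _] := FP _ FX'.
    have [[a xa] [b yb] [e ze]] := XD _ _ _ Xp.
    by split; [exists a|exists b|exists e]; exact: up FX' _.
  - have [X [FX' Xx Xy]] := FX _ _ xz yt; have [_ _ XT] := FP _ FX'.
    have [||w xyw] := XT x y; [by exists z|by exists t|].
    by exists w; exact: up FX' _.
move: gR; set R := R0 `|` Rm => gR; have [Ri RD RT] := gR.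
pose E := D R.
pose p x y := if pselect (exists z, R ((x, y), z)) is left h then sval (cid h) else x.
have pR x y : E x -> E y -> R ((x, y), p x y).
  by move=> Ex Ey; rewrite /p; case: pselect => [h|[]]; [case: cid|exact: RT].
have pE x y : E x -> E y -> E (p x y) by move=> Ex Ey; have [] := RD _ _ _ (pR _ _ Ex Ey).
have pI x y x' y' : E x -> E y -> E x' -> E y' -> p x y = p x' y' -> x = x' /\ y = y'.
  move=> Ex Ey Ex' Ey' h.
  by have /= [_ /(_ h)[-> ->]] := Ri _ _ (pR _ _ Ex Ey) (pR _ _ Ex' Ey').
have Ei n : E (i n) by have [z ?] := D0 n; exists z; left.
have i01 : i 0%nat <> i 1%nat by move=> /iI.
have double (X : set L) j : inj_into (X `\` E) E j -> exists h, inj_into X E h.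
  move=> [jE jI]; exists (fun x => if pselect (E x) then p (i 0%nat) x else p (i 1%nat) (j x)).
  split=> [x Xx|x y Xx Xy].
    by case: pselect => Ex; apply: pE => //; exact: jE.
  case: pselect => Ex; case: pselect => Ey /pI h.
  - by have [] := h (Ei 0%nat) Ex (Ei 0%nat) Ey.
  - by have [] := h (Ei 0%nat) Ex (Ei 1%nat) (jE _ (conj Xy Ey)).
  - by have [] := h (Ei 1%nat) (jE _ (conj Xx Ex)) (Ei 0%nat) Ey => /esym.
  - have [_ /jI] := h (Ei 1%nat) (jE _ (conj Xx Ex)) (Ei 1%nat) (jE _ (conj Xy Ey)).
    by apply.
have [[j jP]|[k [kE kI]]] := comparable_sets (~` E) E.
  have [|h [hE hI]] := double setT j; first by rewrite setTD.
  exists (fun q => p (h q.1) (h q.2)) => -[x y] [x' y'] /= /pI.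
  move=> /(_ (hE _ I) (hE _ I) (hE _ I) (hE _ I))[].
  by move=> /(hI _ _ I I) -> /(hI _ _ I I) ->.
exfalso.
pose X := E `|` k @` E.
pose j x := if pselect (exists2 y, E y & k y = x) is left h then s2val (cid2 h) else x.
have jP x : (X `\` E) x -> E (j x) /\ k (j x) = x.
  move=> [[//|xk] _]; rewrite /j; case: pselect => // h; by case: cid2.
have [|h [hE hI]] := double X j.
  split=> [x /jP[]//|x y /jP[_ xE] /jP[_ yE] jxy].
  by rewrite -xE -yE jxy.
pose R1 : set (L * L * L) := [set t | exists x y, [/\ X x, X y, ~ (E x /\ E y)
  & t = ((x, y), k (p (h x) (h y)))]].
apply: (Rmax (Rm `|` R1)).
  split; first by left.
  have E0 : ~ E (k (i 0%nat)) by exact: kE.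
  have X0 : X (k (i 0%nat)) by right; exists (i 0%nat).
  move=> sub; have /sub Rm0 : (Rm `|` R1) (k (i 0%nat), k (i 0%nat), k (p (h (k (i 0%nat))) (h (k (i 0%nat))))).
    by right; exists (k (i 0%nat)), (k (i 0%nat)); split=> // -[].
  by have [] := RD _ _ _ (or_intror Rm0 : R _).
rewrite /= setUA -/R.
have EX x : E x -> X x by left.
have DX x : D (R `|` R1) x -> X x.
  by move=> [z [/RD[/EX]//|[y [y' [Xy _ _ [-> _ _]]]]]].
have XD x : X x -> D (R `|` R1) x.
  move=> Xx; have [Ex|nEx] := pselect (E x).
    by exists (p x x); left; exact: pR.
  by exists (k (p (h x) (h x))); right; exists x, x; split=> // -[].
split=> [q q' [Rq|[x [y [Xx Xy nE ->]]]] [Rq'|[x' [y' [Xx' Xy' nE' ->]]]]|x y z|x y].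
- exact: Ri.
- case: q Rq => [[u v] w] Rq /=; have [Eu Ev Ew] := RD _ _ _ Rq.
  split=> [[ux vy]|wk]; first by case: nE'; rewrite -ux -vy.
  by case: (kE (p (h x') (h y'))); rewrite -?wk //; apply: pE; exact: hE.
- case: q' Rq' => [[u v] w] Rq /=; have [Eu Ev Ew] := RD _ _ _ Rq.
  split=> [[ux vy]|wk]; first by case: nE; rewrite ux vy.
  by case: (kE (p (h x) (h y))); rewrite ?wk //; apply: pE; exact: hE.
- split=> [[-> -> //]|/= /kI].
  move=> /(_ (pE _ _ (hE _ Xx) (hE _ Xy)) (pE _ _ (hE _ Xx') (hE _ Xy'))).
  move=> /(pI _ _ _ _ (hE _ Xx) (hE _ Xy) (hE _ Xx') (hE _ Xy'))[].
  by move=> /(hI _ _ Xx Xx') -> /(hI _ _ Xy Xy') ->.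
- move=> [/RD[Ex Ey Ez]|[u [v [Xu Xv _ [-> -> ->]]]]]; first by split; apply/XD/EX.
  split; try exact: XD.
  by apply: XD; right; exists (p (h u) (h v)) => //; apply: pE; exact: hE.
- move=> /DX Xx /DX Xy; have [[Ex Ey]|nE] := pselect (E x /\ E y).
    by exists (p x y); left; exact: pR.
  by exists (k (p (h x) (h y))); right; exists x, y.
Qed.

(** * Extending triangle-free graphs to members of [K0'] *)

(** [New x y l] is a new vertex joined to [x], and to [y] unless this creates a
    triangle; the label [l] provides copies that occur in no given tree. *)
Inductive tree (V : Type) := Base of V | Root | New of tree V & tree V & tree V.
Arguments Root {V}.

Fixpoint tree_size (V : Type) (t : tree V) : nat :=
  if t is New x y l then (tree_size x + tree_size y + tree_size l).+1 else 0.

Section Tree.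
Variable Gm : graph.
Implicit Types x y z u v w : tree Gm.

Fixpoint below (z w : tree Gm) : Prop :=
  match z with
  | Base a => if w is Base b then adj a b else False
  | Root => False
  | New x y _ => w = x \/ (w = y /\ ~ (below x y \/ below y x))
  end.

Definition tree_adj z w : Prop := below z w \/ below w z.

Lemma below_size z w : below z w ->
  (tree_size w < tree_size z)%nat \/ (tree_size w = 0 /\ tree_size z = 0).
Proof.
case: z => [a|//|x y l]; first by case: w => //; right.
by case=> [->|[-> _]]; left => /=; lia.
Qed.

Lemma tree_adj_sym z w : tree_adj z w -> tree_adj w z.
Proof. by case; [right|left]. Qed.

Lemma tree_adj_irr z : ~ tree_adj z z.
Proof.
suff H : ~ below z z by case.
move=> zz; have := below_size zz; case: z zz => [a /adj_irr//|//|x y l _] /=; lia.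
Qed.

Definition tree_graph : graph := Graph tree_adj_sym tree_adj_irr.

Lemma tree_adjNew z x y l : (tree_size z <= tree_size (New x y l))%nat ->
  tree_adj (New x y l) z -> z = x \/ (z = y /\ ~ tree_adj x y).
Proof. by move=> zl [//|/below_size/=]; move: zl => /=; lia. Qed.

Lemma Base_emb : induced_emb (fun a => Base a : tree_graph).
Proof.
split=> [a b [] //|a b]; split=> /= [[//|/adj_sym //]|]; by left.
Qed.

(** If the largest vertex of a triangle is a [New], the others are among its first two arguments,
    both joined to it only when they are not adjacent. If it is a [Base], the triangle comes from
    [Gm]. *)
Lemma tree_triangle_free : triangle_free Gm -> triangle_free tree_graph.
Proof.
move=> tf.
have top z u v : tree_adj z u -> tree_adj z v -> tree_adj u v ->
    (tree_size u <= tree_size z)%nat -> (tree_size v <= tree_size z)%nat -> False.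
  case: z => [a|/= |x y l].
  - case: u => [b|[]//|? ? ?] + + + + //.
    case: v => [d|_ []//|? ? ?] + + + + + //=.
    move=> ab ad bd _ _; apply: (tf a b d); split.
    + by case: ab => // /adj_sym.
    + by case: bd => // /adj_sym.
    + by case: ad => // /adj_sym.
  - move=> [//|]; case: u => [b []| |? ? ?] //= *; lia.
  - move=> /[swap] zv /[swap] uv /[swap] us /[swap] vs.
    move: zv => /(tree_adjNew vs) zv zu; have {zu} := tree_adjNew us zu.
    case: zv => [vE|[vE nxy]] [uE|[uE nxy']]; rewrite uE vE in uv.
    + exact: tree_adj_irr uv.
    + by apply: nxy'; exact: tree_adj_sym.
    + exact: nxy.
    + exact: tree_adj_irr uv.
move=> x y z /= [xy yz xz].
have [yx zx] := (tree_adj_sym xy, tree_adj_sym xz); have zy := tree_adj_sym yz.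
have [h1|h1] := leqP (tree_size x) (tree_size y);
  have [h2|h2] := leqP (tree_size y) (tree_size z);
  have [h3|h3] := leqP (tree_size x) (tree_size z).
all: try by apply: (top z x y) => //; lia.
all: try by apply: (top y x z) => //; lia.
all: by apply: (top x y z) => //; lia.
Qed.

Lemma new_fresh x y v : ~ tree_adj v x -> ~ tree_adj v y -> v <> x -> v <> y ->
  (~` star (v : tree_graph)) (New x y v).
Proof.
move=> nvx nvy vx vy [nv|/=]; first by have := congr1 (@tree_size _) nv => /=; lia.
move=> /tree_adj_sym/tree_adjNew; case=> [/= | |[]] //; lia.
Qed.

Lemma K0'_tree : triangle_free Gm -> K0' tree_graph.
Proof.
move=> tf; split.
(* The label [w] makes this neighbour of [v] larger than [w], so it is adjacent to [w] only if [w]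
   is [v]. *)
- move=> v w vw vsw; have : star (v : tree_graph) (New v v w) by right; right; left.
  move=> /vsw[/(congr1 (@tree_size _))/=|]; first lia.
  by move=> /tree_adj_sym/tree_adjNew; case=> [/= | |[]] //; [lia|move=> /esym..].
- move=> v [x xv] [y yv].
  have xv' := set_mem xv; have yv' := set_mem yv.
  have nvx : ~ tree_adj v x by move=> h; apply: xv'; right.
  have nvy : ~ tree_adj v y by move=> h; apply: yv'; right.
  have vx : v <> x by move=> h; apply: xv'; left.
  have vy : v <> y by move=> h; apply: yv'; left.
  have [xy|nxy] := pselect (tree_adj x y); first exact: rt_step.
  (* The label [v] makes this common neighbour of [x] and [y] larger than [v], which keeps it out of
     the star of [v]. *)
  have zv := new_fresh nvx nvy vx vy.
  apply: (rt_trans _ _ _ (exist _ (New x y v) (mem_set zv))).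
    by apply: rt_step; right; left.
  by apply: rt_step; left; right.
- exact: tree_triangle_free.
(* [Root] and [y] are opposite corners, [y] being built so as not to be joined to [Root]; [z1] and
   [z2] are common neighbours that differ only by their labels. *)
- pose a : tree_graph := New Root Root Root; pose y : tree_graph := New a a a.
  pose z1 : tree_graph := New Root y Root; pose z2 : tree_graph := New Root y y.
  have n02 : ~ tree_adj (Root : tree_graph) y by case=> //= [[|[]]].
  have n13 : ~ tree_adj z1 z2 by case=> [[|[]]|[|[]]].
  have a01 : tree_adj (Root : tree_graph) z1 by right; left.
  have a03 : tree_adj (Root : tree_graph) z2 by right; left.
  have a12 : tree_adj z1 y by left; right.
  have a32 : tree_adj z2 y by left; right.
  have [n20 n31] := (fun h => n02 (tree_adj_sym h), fun h => n13 (tree_adj_sym h)).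
  have [[a10 a30] [a21 a23]] := (tree_adj_sym a01, tree_adj_sym a03, (tree_adj_sym a12, tree_adj_sym a32)).
  exists (fun i => nth Root [:: Root; z1; y; z2] i); split.
    by move=> [[|[|[|[|//]]]] i] [[|[|[|[|//]]]] j] //= _; apply/val_inj.
  move=> [[|[|[|[|//]]]] i] [[|[|[|[|//]]]] j] //; split=> //=; try by move=> /tree_adj_irr.
Qed.

End Tree.

(** * The right-angled Coxeter group of a graph *)

Definition racg (Gm : graph) : Type := {X : set (seq Gm) | exists w, X = weq w}.

HB.instance Definition _ (Gm : graph) := gen_eqMixin (racg Gm).
HB.instance Definition _ (Gm : graph) := gen_choiceMixin (racg Gm).

Section Racg.
Variable Gm : graph.
Implicit Types (u v w : seq Gm) (g h : racg Gm).

Definition racg_pi w : racg Gm := exist _ (weq w) (ex_intro _ w erefl).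
Definition racg_repr g : seq Gm := sval (cid (proj2_sig g)).

Lemma racg_piP u v : racg_pi u = racg_pi v <-> weq u v.
Proof.
split=> [/(congr1 sval) /= ->|uv]; first exact: weq_refl.
rewrite /racg_pi; apply: eq_exist; apply/predeqP => w; split=> h.
  exact: weq_trans (weq_sym uv) h.
exact: weq_trans uv h.
Qed.

Lemma racg_reprK g : racg_pi (racg_repr g) = g.
Proof.
by case: g => X Xw; apply: eq_exist; rewrite /racg_repr /=; case: cid => w /= ->.
Qed.

Lemma racg_repr_pi w : weq (racg_repr (racg_pi w)) w.
Proof. by apply/racg_piP; rewrite racg_reprK. Qed.

Definition racg_mul g h := racg_pi (racg_repr g ++ racg_repr h).
Definition racg_inv g := racg_pi (rev (racg_repr g)).

Lemma racg_mulE u v : racg_mul (racg_pi u) (racg_pi v) = racg_pi (u ++ v).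
Proof. by apply/racg_piP; apply: weq_cat; exact: racg_repr_pi. Qed.

Lemma racg_mulA : associative racg_mul.
Proof.
move=> g h k; rewrite -(racg_reprK g) -(racg_reprK h) -(racg_reprK k).
by rewrite !racg_mulE catA.
Qed.

Lemma racg_mul1 : left_id (racg_pi [::]) racg_mul.
Proof. by move=> g; rewrite -(racg_reprK g) racg_mulE. Qed.

Lemma racg_mulr1 : right_id (racg_pi [::]) racg_mul.
Proof. by move=> g; rewrite -(racg_reprK g) racg_mulE cats0. Qed.

Lemma racg_mulV : left_inverse (racg_pi [::]) racg_inv racg_mul.
Proof.
by move=> g; rewrite -{2}(racg_reprK g) racg_mulE; apply/racg_piP; exact: weq_revK.
Qed.

Lemma racg_mulrV : right_inverse (racg_pi [::]) racg_inv racg_mul.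
Proof.
move=> g; rewrite -{1}(racg_reprK g) racg_mulE; apply/racg_piP.
by have := weq_revK (rev (racg_repr g)); rewrite revK.
Qed.

HB.instance Definition _ := isGroup.Build (racg Gm)
  racg_mulA racg_mul1 racg_mulr1 racg_mulV racg_mulrV.

Definition racg_gen (x : Gm) : racg Gm := racg_pi [:: x].

Lemma cev_racg w : cev racg_gen w = racg_pi w.
Proof.
elim: w => [|x w IH]; first by rewrite cev_nil.
by rewrite cev_cons IH; exact: racg_mulE.
Qed.

Lemma racg_coxsys : coxsys racg_gen.
Proof.
split; last by move=> g; exists (racg_repr g); rewrite cev_racg racg_reprK.
split=> [x|x y xy|w].
- by rewrite -[_ * _]/(racg_mul _ _) racg_mulE; apply/racg_piP; exact: (weq_del [::]).
- rewrite /commute -[_ * _]/(racg_mul _ _) -[RHS]/(racg_mul _ _) !racg_mulE.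
  by apply/racg_piP; exact: (weq_swap [::] [::] xy).
- by rewrite cev_racg => /racg_piP.
Qed.

Lemma racg_repr_inj : injective racg_repr.
Proof. exact: can_inj racg_reprK. Qed.

End Racg.

(** * Sizes *)

Definition embeds (T U : Type) : Prop := exists f : T -> U, injective f.

Lemma embeds_trans T U V : embeds T U -> embeds U V -> embeds T V.
Proof. by move=> [f fI] [g gI]; exists (g \o f); exact: inj_comp. Qed.

Lemma embeds_card (T U : Type) : embeds T U -> [set: T] #<= [set: U].
Proof.
move=> [f fI]; apply: card_le_trans (subset_card_le (@subsetT _ (range f))).
have /card_esym := @inj_card_eq _ _ setT f (in2W fI).
by rewrite card_eq_le => /andP[].
Qed.

Lemma embeds_lt (T U V : Type) : embeds T U -> card_lt [set: U] [set: V] ->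
  card_lt [set: T] [set: V].
Proof.
by move=> /embeds_card TU UV VT; apply: UV; exact: card_le_trans VT TU.
Qed.

Section Embeds.
Variable L : Type.
Hypothesis Linf : infinite_set [set: L].

Lemma embeds_tags : exists (p : L -> L -> L) (i : nat -> L), [/\ injective i &
  forall x y x' y', p x y = p x' y' -> x = x' /\ y = y'].
Proof.
have [p pI] := infinite_pairing Linf.
have [i iI] := infinite_sequence Linf.
by exists (fun x y => p (x, y)), i; split=> // x y x' y' /pI[-> ->].
Qed.

Lemma embeds_option T : embeds T L -> embeds (option T) L.
Proof.
move=> [f fI]; have [p [i [iI pI]]] := embeds_tags.
exists (fun o => if o is Some x then p (i 0%nat) (f x) else p (i 1%nat) (i 1%nat)).
by move=> [x|] [y|] // /pI[] => [_ /fI ->|/iI|/iI].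
Qed.

Lemma embeds_seq T : embeds T L -> embeds (seq T) L.
Proof.
move=> [f fI]; have [p [i [iI pI]]] := embeds_tags.
exists (foldr (fun x c => p (i 0%nat) (p (f x) c)) (p (i 1%nat) (i 1%nat))).
elim=> [|x s IH] [|y t] //= /pI[] => [/iI //|/iI //|_ /pI[/fI -> /IH -> //]].
Qed.

Lemma embeds_tree T : embeds T L -> embeds (tree T) L.
Proof.
move=> [f fI]; have [p [i [iI pI]]] := embeds_tags.
pose fix code (t : tree T) : L :=
  match t with
  | Base x => p (i 0%nat) (f x)
  | Root => p (i 1%nat) (i 1%nat)
  | New x y l => p (i 2%nat) (p (code x) (p (code y) (code l)))
  end.
exists code; elim=> [x| |x IHx y IHy l IHl] [x'| |x' y' l'] //= /pI[] //;
  try by move=> /iI.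
  by move=> _ /fI ->.
by move=> _ /pI[/IHx -> /pI[/IHy -> /IHl ->]].
Qed.

Lemma embeds_racg (Gm : graph) : embeds Gm L -> embeds (racg Gm) L.
Proof.
move=> /embeds_seq; apply: embeds_trans.
by exists (@racg_repr Gm); exact: racg_repr_inj.
Qed.

End Embeds.

Lemma embeds_infinite (M alpha : Type) : ~ countable [set: M] ->
  card_lt [set: alpha] [set: M] ->
  exists L, [/\ infinite_set [set: L], card_lt [set: L] [set: M] & embeds alpha L].
Proof.
move=> Munc aM; have [ainf|afin] := pselect (infinite_set [set: alpha]).
  by exists alpha; split=> //; exists id.
exists nat; split=> //; first exact: infinite_nat.
have /countable_injP[f fI] : countable [set: alpha].
  by apply: finite_set_countable; apply: contrapT.
by exists f => x y; apply: fI; rewrite inE.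
Qed.

(** * Coxeter bases *)

Definition spanned (Gm : graph) (G : groupType) (c : Gm -> G) : set G :=
  [set g | exists w, cev c w = g].

(** Passing to the abstract group of the graph makes the results on [coxsys] available for a
    [psys]. *)
Lemma psys_racg (Gm : graph) (G : groupType) (c : Gm -> G) u v : psys c ->
  cev c u = cev c v -> cev (@racg_gen Gm) u = cev (@racg_gen Gm) v.
Proof.
by move=> hc /(psys_eqP _ _ hc) uv; apply/(psys_eqP _ _ (proj1 (racg_coxsys Gm))).
Qed.

Lemma psys_inj (Gm : graph) (G : groupType) (c : Gm -> G) : psys c -> injective c.
Proof.
move=> hc x y xy; apply: (c_inj (racg_coxsys Gm)); rewrite -!cev1.
by apply: (psys_racg hc); rewrite !cev1.
Qed.

Lemma psys_adj (Gm : graph) (G : groupType) (c : Gm -> G) x y : psys c ->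
  x <> y -> commute (c x) (c y) -> adj x y.
Proof.
move=> hc xy cxy; apply: (adj_commute (racg_coxsys Gm) xy).
have := @psys_racg _ _ _ [:: x; y] [:: y; x] hc.
by rewrite !cev_cons !cev_nil !mulg1; apply.
Qed.

Lemma word_eq_weq (G : groupType) (S : set G) (E : S -> S -> Prop) (u v : word S) :
  (forall s t, E s t -> coxeter_adj s t) -> word_eq (racg_relators E) u v ->
  weq (Gm := coxeter_graph S) (map fst u) (map fst v).
Proof.
move=> EC; elim=> {u v} [w|u v _|u v w _ + _|u u' v v' _ uu _ vv|x b|r].
- exact: weq_refl.
- exact: weq_sym.
- exact: weq_trans.
- by rewrite !map_cat; exact: weq_cat.
- exact: (weq_del [::] [::] (x : coxeter_graph S)).
- move=> [[s ->]|[s [t [/EC st ->]]]] /=.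
    exact: (weq_del [::] [::] (s : coxeter_graph S)).
  have ts := @adj_sym (coxeter_graph S) _ _ st.
  apply: (weq_trans (@weq_swap (coxeter_graph S) [:: s] [:: t] _ _ ts)).
  apply: (weq_trans (@weq_del (coxeter_graph S) [::] [:: t; t] s)).
  exact: (weq_del [::] [::] (t : coxeter_graph S)).
Qed.

(** The pairs in [E] commute, hence are edges of [coxeter_graph S]; a word that is trivial by the
    presentation is therefore trivial for [weq]. *)
Lemma basis_psys (G : groupType) (H S : set G) : coxeter_basis H S ->
  psys (fun s : coxeter_graph S => val s) /\
  forall g, H g <-> spanned (fun s : coxeter_graph S => val s) g.
Proof.
move=> [E [Eneq [Hgen Hrel]]].
have v2 (s : S) : val s * val s = 1.
  have /Hrel : word_eq (racg_relators E) [:: (s, false); (s, false)] [::].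
    by apply: word_eq_rel; left; exists s.
  by rewrite /word_val !big_cons big_nil mulg1.
have vV (s : S) : (val s)^-1 = val s by exact: mulg1_eq.
have EC s t : E s t -> coxeter_adj s t.
  move=> st; split; first exact: Eneq.
  have /Hrel : word_eq (racg_relators E)
      [:: (s, false); (t, false); (s, false); (t, false)] [::].
    by apply: word_eq_rel; right; exists s, t.
  rewrite /word_val !big_cons big_nil mulg1 /= => h.
  have h' : (val s * val t)^-1 = val s * val t by apply: mulg1_eq; rewrite -mulgA.
  by rewrite /commute -h' invgM !vV.
have wE (w : word S) : word_val w = cev (fun s : coxeter_graph S => val s) (map fst w).
  rewrite /word_val /cev big_map; apply: eq_bigr => -[s b] _ /=.
  by case: b; rewrite ?vV.
have fE (w : seq S) : map fst [seq (s, false) | s <- w] = w.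
  by rewrite -map_comp map_id.
split.
  split=> [s|s t []//|w wE1]; first exact: v2.
  have /Hrel/(word_eq_weq EC) : word_val [seq (s, false) | s <- w] = 1.
    by rewrite wE fE.
  by rewrite fE.
move=> g; rewrite Hgen; split=> [[w <-]|[w <-]].
  by exists (map fst w); rewrite wE.
by exists [seq (s, false) | s <- w]; rewrite wE fE.
Qed.

Lemma basis_coxsys (G : groupType) (S : set G) : coxeter_basis [set: G] S ->
  coxsys (fun s : coxeter_graph S => val s).
Proof. by move=> /basis_psys[hp hg]; split=> // g; apply/hg. Qed.

Definition ivert (Gm : graph) (U : set Gm) x (Ux : U x) : induced U :=
  exist (fun y => y \in U) x (mem_set Ux).

Lemma K0'_iso (Gm Dm : graph) (f : Gm -> Dm) (g : Dm -> Gm) :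
  cancel f g -> cancel g f -> (forall x y, adj (f x) (f y) <-> adj x y) ->
  K0' Gm -> K0' Dm.
Proof.
move=> fK gK fadj [sp sc tf [h [hI hE]]].
have gadj x y : adj (g x) (g y) <-> adj x y by rewrite -fadj !gK.
have stf v w : star (f v) (f w) <-> star v w.
  by rewrite /star /=; split=> [[/(can_inj fK)->|/fadj]|[->|/fadj]]; by [left|right].
split.
- move=> v w vw vsw; apply: (sp (g v) (g w)) => [/(can_inj gK)//|x xv].
  by apply/stf; rewrite gK; apply: vsw; rewrite -(gK v); apply/stf.
- move=> v x y.
  have cg (z : induced (~` star v)) : (~` star (g v)) (g (val z)).
    by move=> /stf; rewrite !gK; have := valP z; rewrite inE.
  have cf (z : induced (~` star (g v))) : (~` star v) (f (val z)).
    by case: z => z zv /=; rewrite -(gK v) => /stf; exact: (set_mem zv).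
  pose P (u : induced (~` star (g v))) := forall z : induced (~` star v),
    val z = f (val u) -> clos_refl_trans _ (@adj (induced (~` star v))) x z.
  have Py : P (ivert (cg y)).
    apply: (@connected_ind _ P (ivert (cg x)) _ (sc (g v))).
      move=> u u' uu' Pu z zE.
      apply: (rt_trans _ _ _ (ivert (cf u))); first exact: Pu.
      by apply: rt_step; rewrite /= zE; apply/fadj.
    move=> z; rewrite /= gK => /val_inj ->; exact: rt_refl.
  by apply: Py; rewrite /= gK.
- move=> x y z [/gadj xy /gadj yz /gadj xz].
  by apply: (tf (g x) (g y) (g z)); split.
- exists (f \o h); split; first exact: inj_comp (can_inj fK) hI.
  by move=> i j /=; rewrite fadj.
Qed.

Section Basis.
Variables (Gm : graph) (G : groupType) (c : Gm -> G) (hc : psys c).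
Local Notation S := (range c).

Definition gen_idx (s : S) : Gm := s2val (cid2 (set_mem (valP s))).
Lemma gen_idxK (s : S) : c (gen_idx s) = val s.
Proof. by rewrite /gen_idx; case: cid2. Qed.
Definition gen_mk (x : Gm) : S := exist _ (c x) (mem_set (imageT c x)).
Lemma gen_mkK : cancel gen_mk gen_idx.
Proof. by move=> x; apply: (psys_inj hc); rewrite gen_idxK. Qed.
Lemma gen_idxKV : cancel gen_idx gen_mk.
Proof. by move=> s; apply: val_inj; rewrite /= gen_idxK. Qed.

Let E (s t : S) : Prop := adj (gen_idx s) (gen_idx t).
Let R := racg_relators E.
Let lift (w : seq Gm) : word S := [seq (gen_mk x, false) | x <- w].

Lemma gen_word_val (w : word S) : word_val w = cev c (map (gen_idx \o fst) w).
Proof.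
rewrite /word_val /cev big_map; apply: eq_bigr => -[s b] _ /=.
by case: b => /=; rewrite -gen_idxK // (psys_inv _ hc).
Qed.

Let word_eqC (u u' v v' : word S) : word_eq R u u' -> word_eq R v v' ->
  word_eq R (u ++ v) (u' ++ v').
Proof. exact: word_eq_cat. Qed.

Lemma lift_weq u v : weq u v -> word_eq R (lift u) (lift v).
Proof.
have del (s : S) : word_eq R [:: (s, false); (s, false)] [::].
  by apply: word_eq_rel; left; exists s.
elim=> {u v} [w|u v _|v u w _ + _|u v x|u v x y xy].
- exact: word_eq_refl.
- exact: word_eq_sym.
- exact: word_eq_trans.
- rewrite /lift !map_cat; apply: word_eqC (word_eq_refl _ _) _.
  exact: (word_eqC (del _) (word_eq_refl _ _)).
- rewrite /lift !map_cat; apply: word_eqC (word_eq_refl _ _) _ => /=.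
  set s := gen_mk x; set t := gen_mk y.
  apply: (@word_eqC [:: (s, false); (t, false)] [:: (t, false); (s, false)])
    (word_eq_refl _ _).
  have st : word_eq R [:: (s, false); (t, false); (s, false); (t, false)] [::].
    by apply: word_eq_rel; right; exists s, t; rewrite /E !gen_mkK.
  have h := word_eqC st (word_eq_refl R [:: (t, false); (s, false)]).
  apply: word_eq_trans _ h; apply: word_eq_sym => /=.
  rewrite -[X in word_eq R _ X]/([:: (s, false); (t, false)] ++ [::]).
  apply: (@word_eqC [:: (s, false); (t, false)] _
    [:: (s, false); (t, false); (t, false); (s, false)] [::] (word_eq_refl _ _)).
  apply: word_eq_trans (del s).
  apply: (@word_eqC [:: (s, false)] _ [:: (t, false); (t, false); (s, false)]
    [:: (s, false)] (word_eq_refl _ _)).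
  exact: (@word_eqC [:: (t, false); (t, false)] [::] [:: (s, false)] _ (del t)
    (word_eq_refl _ _)).
Qed.

Lemma lift_idx (w : word S) : word_eq R w (lift (map (gen_idx \o fst) w)).
Proof.
elim: w => [|[s b] w IH] /=; first exact: word_eq_refl.
apply: (@word_eqC [:: (s, b)] [:: (gen_mk (gen_idx s), false)]) IH.
rewrite gen_idxKV; case: b; last exact: word_eq_refl.
apply: (@word_eq_trans _ _ _ ([:: (s, true)] ++ [:: (s, false); (s, false)])).
  rewrite -[X in word_eq R X]cats0; apply: word_eqC (word_eq_refl _ _) _.
  by apply: word_eq_sym; apply: word_eq_rel; left; exists s.
rewrite -[X in word_eq R _ X]cat0s.
exact: (@word_eqC [:: (s, true); (s, false)] [::] [:: (s, false)] _
  (word_eq_cancel _ _ _) (word_eq_refl _ _)).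
Qed.

Lemma word_eq_val (u v : word S) : word_eq R u v -> word_val u = word_val v.
Proof.
elim=> {u v} [//|u v _ -> //|u v w _ -> _ -> //|u u' v v' _ uu _ vv|s b|r].
- by move: uu vv; rewrite !gen_word_val !map_cat !cev_cat => -> ->.
- by rewrite !gen_word_val /= !cev_cons !cev_nil mulg1 (psysV hc).
move=> [[s ->]|[s [t [st ->]]]]; rewrite !gen_word_val /= !cev_cons !cev_nil mulg1.
  exact: psysV.
rewrite [X in _ * X]mulgA -(psysC hc st) -mulgA (psysV hc) mulg1; exact: psysV.
Qed.

Lemma psys_basis : coxeter_basis (spanned c) S.
Proof.
exists E; split; first by move=> s t st ste; apply: (@adj_irr Gm (gen_idx s));
  rewrite {2}ste.
split=> [g|w]; split.
- move=> [w <-]; exists (lift w); rewrite gen_word_val /lift -map_comp.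
  by congr cev; rewrite -[RHS]map_id; apply: eq_map => x /=; rewrite gen_mkK.
- by move=> [w <-]; exists (map (gen_idx \o fst) w); rewrite gen_word_val.
- rewrite gen_word_val => /(psysP hc)/lift_weq; apply: word_eq_trans.
  exact: lift_idx.
- by move=> /word_eq_val ->; rewrite /word_val big_nil.
Qed.

Lemma psys_K0 : K0' Gm -> K0 (spanned c).
Proof.
move=> KG; exists (range c); split; first exact: psys_basis.
apply: (@K0'_iso Gm (coxeter_graph (range c)) gen_mk gen_idx) KG.
- exact: gen_mkK.
- exact: gen_idxKV.
move=> x y; split=> [[xy cxy]|xy].
  by apply: (psys_adj hc) => [h|]; [apply: xy; rewrite h | exact: cxy].
split; last exact: psysC.
by move=> /(can_inj gen_mkK) h; apply: (@adj_irr Gm x); rewrite {2}h.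
Qed.

End Basis.

Lemma coxsys_span (Gm : graph) (G : groupType) (c : Gm -> G) : coxsys c ->
  spanned c = [set: G].
Proof. by move=> [_ hg]; apply/predeqP => g; split=> // _; exact: hg. Qed.

Lemma spanned_subgroup (Gm : graph) (G : groupType) (c : Gm -> G) :
  (forall x, c x * c x = 1) -> is_subgroup (spanned c).
Proof.
move=> cV; split=> [|x y [u <-] [v <-]|x [u <-]].
- by exists [::]; rewrite cev_nil.
- by exists (u ++ v); rewrite cev_cat.
- exists (rev u); elim: u => [|z u IH]; first by rewrite cev_nil invg1.
  by rewrite rev_cons -cats1 cev_cat cev1 IH cev_cons invgM (mulg1_eq (cV z)).
Qed.

Lemma spanned_strong (Gm Dm : graph) (G : groupType) (c : Dm -> G) (e : Gm -> Dm) :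
  coxsys c -> induced_emb e -> strong_sub (spanned (c \o e)) [set: G].
Proof.
move=> hc he; have hp := proj1 hc; have hce := psys_sub he hp; split=> //.
  by apply: spanned_subgroup => x; exact: psysV hp _.
exists (range c); split; first by rewrite -(coxsys_span hc); exact: psys_basis.
suff -> : spanned (c \o e) `&` range c = range (c \o e) by exact: psys_basis.
apply/predeqP => g; split=> [[[w wE] [y _ yE]]|[x _ <-]]; last first.
  by split; [exists [:: x]; rewrite cev1 | exists (e x)].
have : inP c (range e) (c y).
  exists (map e w); last by rewrite cev_map wE yE.
  by rewrite all_map; elim: (w) => //= x w' ->; rewrite andbT; apply/asboolP; exists x.
(* [c y] has coordinate 1 at [y] in the abelianization, so [y] must be one of the letters
   available. *)
move=> yP; have [|x _ xy] := @inP_chi _ _ _ hc _ _ y yP.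
  by rewrite chic asboolT.
by exists x; rewrite //= xy.
Qed.

(** * Embeddings into the monster model *)

Lemma morph1 (G H : groupType) (f : G -> H) : {morph f : x y / x * y} -> f 1 = 1.
Proof. by move=> fM; apply: (mulgI (f 1)); rewrite -fM !mulg1. Qed.

Lemma morphV (G H : groupType) (f : G -> H) : {morph f : x y / x * y} ->
  {morph f : x / x^-1}.
Proof. by move=> fM x; apply/esym/mulg1_eq; rewrite -fM mulgV morph1. Qed.

Lemma morphJ (G H : groupType) (f : G -> H) : {morph f : x y / x * y} ->
  {morph f : x y / x ^ y}.
Proof. by move=> fM x y; rewrite !conjgE !fM morphV. Qed.

Lemma morph_commute (G H : groupType) (f : G -> H) x y : {morph f : x y / x * y} ->
  injective f -> commute (f x) (f y) <-> commute x y.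
Proof. by move=> fM fI; rewrite /commute -!fM; split=> [/fI|->]. Qed.

Lemma range_coxsys (G H : groupType) (f : G -> H) (T : set H) :
  {morph f : x y / x * y} -> injective f -> coxeter_basis (range f) T ->
  exists2 c : coxeter_graph T -> G, coxsys c & forall t, f (c t) = val t.
Proof.
move=> fM fI /basis_psys[hp hg].
have Tf (t : coxeter_graph T) : exists g, f g = val t.
  have [g _ gE] : range f (val t) by apply/hg; exists [:: t]; rewrite cev1.
  by exists g.
have [c cE] := choice Tf; exists c => //.
have fcE : f \o c = (fun t => val t) by apply/funext => t; exact: cE.
have fc w : f (cev c w) = cev (fun t : coxeter_graph T => val t) w.
  by rewrite morph_cev // fcE.
split; first split=> [t|s t st|w w1].
- by apply: fI; rewrite fM cE morph1 // (psysV hp).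
- by apply/(morph_commute _ _ fM fI); rewrite !cE; exact: (psysC hp st).
- by apply: (psysP hp); rewrite -fc w1 morph1.
move=> g; have /hg[w wE] : range f (f g) by exists g.
by exists w; apply: fI; rewrite fc.
Qed.

Section Monster.
Variable M : groupType.
Hypothesis hM : monster K0 M.

(** Universality gives a basis [S] of [M] that meets the image of [f] in a basis of this image.
    Rigidity in [M] relates [S] to the fixed basis [S0], and rigidity in [racg Gm] relates the part
    of [S] in the image to the images of the generators. *)
Lemma monster_embed (Gm : graph) : K0' Gm -> card_lt [set: racg Gm] [set: M] ->
  exists (Dm : graph) (c : Dm -> M) (e : Gm -> Dm),
    [/\ K0' Dm, coxsys c & induced_emb e].
Proof.
move=> KG ltM; have [[S0 [bS0 KS0]] _ univ _] := hM.
have hr := racg_coxsys Gm.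
have KN : K0 [set: racg Gm].
  by rewrite -(coxsys_span hr); apply: psys_K0 => //; case: hr.
have [f [fM fI [_ _ _ [S [bS bT]]]]] := univ _ KN ltM.
have [g [phi [phiE _]]] := rigidity (basis_coxsys bS0) (basis_coxsys bS) KS0.
have [c' hc' fc'] := range_coxsys fM fI bT.
have [h [psi [psiE psiS]]] := rigidity hr hc' KG.
have [t tE] := choice psiS.
have tS x : S (val (t x)) by have /set_mem[] := valP (t x).
pose s x : coxeter_graph S := exist (fun y => y \in S) _ (mem_set (tS x)).
(* Conjugation by [g] turns [S0] into [S]; conjugation by [(f h)^-1] then turns the part of [S] in
   the image into the images of the generators. *)
pose c (z : coxeter_graph S0) := val z ^ (g * (f h)^-1).
have hc : coxsys c.
  exact: (coxsys_morph (basis_coxsys bS0) (conjg_morph _) (conjg_bij _)).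
pose e x := phi (s x).
have ceE x : c (e x) = f (racg_gen x).
  rewrite /c conjgM -phiE /= -fc' psiE tE morphJ // conjgK.
  by [].
exists (coxeter_graph S0), c, e; split=> //; split=> [x y xy|x y].
  by apply: (c_inj hr); apply: fI; rewrite -!ceE xy.
have cE : commute (c (e x)) (c (e y)) <-> commute (racg_gen x) (racg_gen y).
  by rewrite !ceE; exact: morph_commute.
split=> xy.
  apply: (adj_commute hr); last by apply/cE; exact: (psysC (proj1 hc) xy).
  by move=> xyE; apply: (adj_neq xy); rewrite xyE.
apply: (adj_commute hc); last by apply/cE; exact: (psysC (proj1 hr) xy).
move=> /(congr1 c); rewrite !ceE => /fI/(c_inj hr); exact: adj_neq.
Qed.

Lemma spanned_bounded (Gm : graph) (c : Gm -> M) : psys c ->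
  card_lt [set: racg Gm] [set: M] -> bounded (spanned c).
Proof.
move=> hc ltM h; apply: ltM; apply: card_le_trans h _.
suff -> : spanned c = (fun g : racg Gm => cev c (racg_repr g)) @` setT.
  exact: card_image_le.
apply/predeqP => x; split=> [[w <-]|[g _ <-]]; last by exists (racg_repr g).
exists (racg_pi w) => //; apply/(psys_eqP _ _ hc); exact: racg_repr_pi.
Qed.

(** Any copy of [Gm2] in [M] contains a copy of [Gm1]. Model homogeneity carries the given copy of
    [Gm1] to that one, and the inverse automorphism brings [Gm2] back. *)
Lemma monster_extend (Gm1 Gm2 Dm : graph) (c : Dm -> M) (e : Gm1 -> Dm)
    (j : Gm1 -> Gm2) :
  coxsys c -> induced_emb e -> induced_emb j -> K0' Gm1 -> K0' Gm2 ->
  card_lt [set: racg Gm1] [set: M] -> card_lt [set: racg Gm2] [set: M] ->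
  exists2 d : Gm2 -> M, psys d & forall x, d (j x) = c (e x).
Proof.
move=> hc he hj K1 K2 lt1 lt2.
have [Dm2 [c2 [e2 [_ hc2 he2]]]] := monster_embed K2 lt2.
have he2j : induced_emb (e2 \o j).
  case: he2 hj => [e2I e2a] [jI ja]; split; first exact: inj_comp.
  by move=> x y /=; rewrite e2a.
pose b1 := c \o e; pose b2 := c2 \o (e2 \o j).
have h1 : psys b1 := psys_sub he (proj1 hc).
have h2 : psys b2 := psys_sub he2j (proj1 hc2).
pose f x := if pselect (exists w, cev b1 w = x) is left h
  then cev b2 (sval (cid h)) else x.
have fE w : f (cev b1 w) = cev b2 w.
  rewrite /f; case: pselect => [h|[]]; last by exists w.
  by apply/(psys_eqP _ _ h2)/(psys_eqP _ _ h1); case: cid.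
have [_ _ _ homog] := hM.
have [g [[[g' gK gK'] gM] gE]] :
    exists g, automorphism g /\ {in spanned b1, g =1 f}.
  apply: (homog (spanned b1) (spanned b2)).
  - exact: psys_K0.
  - exact: psys_K0.
  - exact: spanned_strong.
  - exact: spanned_strong.
  - exact: spanned_bounded.
  - exact: spanned_bounded.
  - split=> [x [w <-]|x y|x [w <-]].
    + by rewrite fE; exists w.
    + rewrite !inE => -[u <-] [v <-]; rewrite !fE => uv.
      by apply/(psys_eqP _ _ h1)/(psys_eqP _ _ h2).
    + by exists (cev b1 w); [exists w|rewrite fE].
  - move=> x y; rewrite !inE => -[u <-] [v <-].
    by rewrite -cev_cat !fE cev_cat.
have g'M : {morph g' : x y / x * y} by move=> x y; apply: (can_inj gK); rewrite gM !gK'.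
exists (g' \o (c2 \o e2)).
  exact: psys_morph (psys_sub he2 (proj1 hc2)) g'M (can_inj gK').
move=> x /=; apply: (can_inj gK); rewrite gK' gE; last first.
  by rewrite inE; exists [:: x]; rewrite cev1.
by rewrite -[c (e x)]/(b1 x) -(cev1 b1) fE cev1.
Qed.

End Monster.

(** * Adjoining a vertex with prescribed neighbours *)

Section Cone.
Variables (Gm : graph) (X : set Gm).

Definition cone_rel (x y : option Gm) : Prop :=
  match x, y with
  | Some x, Some y => adj x y
  | None, Some x | Some x, None => X x
  | None, None => False
  end.

Lemma cone_sym x y : cone_rel x y -> cone_rel y x.
Proof. by case: x y => [x|] [y|] //=; exact: adj_sym. Qed.

Lemma cone_irr x : ~ cone_rel x x.
Proof. by case: x => [x|] //=; exact: adj_irr. Qed.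

Definition cone : graph := Graph cone_sym cone_irr.
Definition cone_tree : graph := tree_graph cone.
Definition apex : cone_tree := Base (None : cone).
Definition cone_base (x : Gm) : cone_tree := Base (Some x : cone).

Lemma cone_base_emb : induced_emb cone_base.
Proof.
have [BI Badj] := Base_emb cone.
split=> [x y /BI[] //|x y]; exact: iff_trans (Badj _ _) _.
Qed.

Lemma apex_adj x : adj apex (cone_base x) <-> X x.
Proof. by have [_ Badj] := Base_emb cone; exact: iff_trans (Badj _ _) _. Qed.

Lemma K0'_cone : triangle_free Gm -> (forall x y, X x -> X y -> ~ adj x y) ->
  K0' cone_tree.
Proof.
move=> tf Xi; apply: K0'_tree => -[x|] [y|] [z|] //= [xy yz xz] //.
- exact: (Xi x y xz yz xy).
- exact: (Xi x z xy yz xz).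
- exact: (Xi y z xy xz yz).
Qed.

Lemma cone_commute (G : groupType) (d : cone_tree -> G) : psys d ->
  forall x, commute (d apex) (d (cone_base x)) <-> X x.
Proof.
move=> hd x; rewrite -apex_adj; split; last exact: psysC.
exact: psys_adj hd _.
Qed.

(** The element lies in the parabolic subgroups of the star of the apex and of the base, and these
    two sets of vertices meet in [X]. *)
Lemma cone_centralizer (G : groupType) (d : cone_tree -> G) (w : seq Gm) :
  psys d -> commute (d apex) (cev (d \o cone_base) w) ->
  exists2 w', all (fun x => `[< X x >]) w' & cev (d \o cone_base) w = cev (d \o cone_base) w'.
Proof.
move=> hd cw; have hr := racg_coxsys cone_tree.
set z := cev (@racg_gen cone_tree) (map cone_base w).
have cz : commute z (racg_gen apex).
  rewrite /commute /z.
  have := @psys_racg _ _ _ (map cone_base w ++ [:: apex]) (apex :: map cone_base w) hd.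
  rewrite !cev_cat !cev_cons !cev_nil !mulg1 => ->; first by [].
  by rewrite cev_map; exact: commute_sym.
have zB : inP (@racg_gen cone_tree) (range cone_base) z.
  exists (map cone_base w) => //; rewrite all_map.
  by elim: (w) => //= x w' ->; rewrite andbT; apply/asboolP; exists x.
have [u uP uE] := inP_inter hr (centralizer hr cz) zB.
have [w' w'P w'E] : exists2 w', all (fun x => `[< X x >]) w' & map cone_base w' = u.
  elim: u uP {uE} => [|y u IH] /=; first by exists [::].
  move=> /andP[/asboolP[sy [x _ xy]] /IH[w' w'P <-]]; exists (x :: w'); last by rewrite -xy.
  rewrite /= w'P andbT; apply/asboolP/apex_adj; rewrite xy.
  by case: sy => // ya; have := congr1 id xy; rewrite ya.
exists w' => //; rewrite -2!(cev_map d cone_base) w'E; apply/(psys_eqP _ _ hd).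
by apply/(psys_eqP _ _ (proj1 hr)); rewrite uE.
Qed.

End Cone.

Lemma monster_cone (M : groupType) (hM : monster K0 M) (L : Type) (Gm Dm : graph)
    (c : Dm -> M) (e : Gm -> Dm) (X : set Gm) :
  infinite_set [set: L] -> card_lt [set: L] [set: M] -> embeds Gm L ->
  coxsys c -> induced_emb e -> K0' Gm -> (forall x y, X x -> X y -> ~ adj x y) ->
  exists2 d : cone_tree X -> M, psys d & forall x, d (cone_base X x) = c (e x).
Proof.
move=> Linf LM GL hc he KG Xi.
have tf : triangle_free Gm by case: KG.
apply: (monster_extend hM hc he (cone_base_emb X) KG (K0'_cone tf Xi)).
  by apply: embeds_lt LM; exact: embeds_racg.
apply: embeds_lt LM; apply: embeds_racg => //; apply: embeds_tree => //.
exact: embeds_option.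
Qed.

(** * Countable induced subgraphs *)

Definition letters (T : Type) (w : seq T) : set T := [set x | List.In x w].

Lemma countable_letters T (w : seq T) : countable (letters w).
Proof.
apply: finite_set_countable; elim: w => [|x w IH].
  by rewrite (_ : letters _ = set0) //; apply/predeqP.
rewrite (_ : letters _ = [set x] `|` letters w) ?finite_setU //.
by apply/predeqP => y; split=> -[|]; by [left|right].
Qed.

(** Paths are explicit lists, so that a countable set of vertices can be closed under them. *)
Fixpoint avoiding (Gm : graph) (v x : Gm) (p : seq Gm) (y : Gm) : Prop :=
  if p is z :: p' then [/\ adj x z, ~ star v z & avoiding v z p' y] else x = y.

Lemma avoiding_cat (Gm : graph) (v x y z : Gm) p q :
  avoiding v x p y -> avoiding v y q z -> avoiding v x (p ++ q) z.
Proof. by elim: p x => [|u p IH] x /= => [->//|[xu vu uy] yz]; split=> //; exact: IH. Qed.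

Lemma star_connected_avoiding (Gm : graph) (v x y : Gm) : star_connected Gm ->
  ~ star v x -> ~ star v y -> exists p, avoiding v x p y.
Proof.
move=> /(_ v) sc vx vy.
suff: forall a b : induced (~` star v),
    clos_refl_trans _ (@adj (induced (~` star v))) a b ->
    exists p, avoiding v (val a) p (val b).
  by move=> /(_ (ivert (U := ~` star v) vx) (ivert (U := ~` star v) vy)); apply; exact: sc.
move=> a b; elim=> {a b} [a b ab|a|a b d _ [p pE] _ [q qE]].
- by exists [:: val b]; split=> //; exact: (set_mem (valP b)).
- by exists [::].
- by exists (p ++ q); exact: avoiding_cat pE qE.
Qed.

Lemma induced_val_emb (Gm : graph) (U : set Gm) :
  induced_emb (fun x : induced U => val x : Gm).
Proof. by split=> // x y; exact: val_inj. Qed.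

(** Closing off in countably many stages under [op], which supplies witnesses for the star property
    and paths for star-connectedness. The four-cycle is put in at the start, and triangle-freeness
    passes to induced subgraphs. *)
Lemma countable_K0' (Gm : graph) (A : set Gm) : K0' Gm -> countable A ->
  exists H, [/\ A `<=` H, countable H & K0' (induced H)].
Proof.
move=> [sp sc tf [f [fI fE]]] cA.
have opP (t : Gm * Gm * Gm) : exists w : seq Gm, let: (v, x, y) := t in
    (v <> x -> exists2 z, List.In z w & star v z /\ ~ star x z) /\
    (~ star v x -> ~ star v y -> exists2 p, avoiding v x p y & letters p `<=` letters w).
  case: t => [[v x] y].
  have [w1 w1P] : exists w : seq Gm, v <> x ->
      exists2 z, List.In z w & star v z /\ ~ star x z.
    have [vx|vx] := pselect (v = x); first by exists [::].
    have [z zP] : exists z, star v z /\ ~ star x z.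
      apply: contrapT => /forallNP h; apply: (sp v x vx) => z vz.
      by apply: contrapT => xz; apply: (h z).
    by exists [:: z] => _; exists z => //; left.
  have [w2 w2P] : exists p : seq Gm, ~ star v x -> ~ star v y -> avoiding v x p y.
    have [vx|vx] := pselect (star v x); first by exists [::].
    have [vy|vy] := pselect (star v y); first by exists [::].
    by have [p pE] := star_connected_avoiding sc vx vy; exists p.
  exists (w1 ++ w2); split=> [/w1P[z z1 zP]|vx vy].
    by exists z => //; apply/List.in_or_app; left.
  by exists w2; [exact: w2P | move=> z zw; apply/List.in_or_app; right].
have [op {}opP] := choice opP.
pose stage := fix stage n := if n is m.+1 then stage m `|`
    \bigcup_(t in (stage m `*` stage m) `*` stage m) letters (op t)
  else A `|` range f.
pose H := \bigcup_(n in setT) stage n.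
have stageS n m : (n <= m)%nat -> stage n `<=` stage m.
  move=> /subnK <-; elim: (m - n)%nat => [//|k IH] x /IH; by left.
have Hstage x y z : H x -> H y -> H z -> exists n, [/\ stage n x, stage n y & stage n z].
  move=> [i _ xi] [j _ yj] [k _ zk]; exists (maxn i (maxn j k)); split.
  - by apply: (stageS i) xi; rewrite leq_maxl.
  - by apply: (stageS j) yj; rewrite !leq_max leqnn orbT.
  - by apply: (stageS k) zk; rewrite !leq_max leqnn !orbT.
have Hop x y z : H x -> H y -> H z -> letters (op (x, y, z)) `<=` H.
  move=> Hx Hy Hz u uo; have [n [xn yn zn]] := Hstage _ _ _ Hx Hy Hz.
  by exists n.+1 => //; right; exists (x, y, z).
have Hf i : H (f i) by exists 0 => //; right; exists i.
exists H; split.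
- by move=> x Ax; exists 0 => //; left.
- apply: bigcup_countable => // n _; elim: n => [|n IH] /=.
    rewrite -bigcup2E; apply: bigcup_countable => // -[|[|k]] _ //=.
      by apply: finite_set_countable; apply: finite_image; exact: finite_finset.
  rewrite -bigcup2E; apply: bigcup_countable => // -[|[|k]] _ //=.
  apply: bigcup_countable => [|t _]; last exact: countable_letters.
  by apply: countableX => //; exact: countableX.
have Hv (x : induced H) : H (val x) by exact: (set_mem (valP x)).
have stE (v x : induced H) : star (val v) (val x) <-> star v x.
  by rewrite /star /=; split=> [[/val_inj->|]|[->|]]; by [left|right].
split.
- move=> v w vw vsw.
  have [|z zo [vz wz]] := (opP (val v, val w, val w)).1.
    by move=> /val_inj.
  have Hz : H z by exact: Hop zo.
  by apply/wz/(stE w (ivert Hz))/vsw/stE.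
- move=> v x y.
  have vx : ~ star (val v) (val (val x)) by move=> /stE; exact: (set_mem (valP x)).
  have vy : ~ star (val v) (val (val y)) by move=> /stE; exact: (set_mem (valP y)).
  have [p + pH] := (opP (val v, val (val x), val (val y))).2 vx vy.
  have {}pH : letters p `<=` H by move=> z /pH; exact: Hop.
  elim: p x vx pH => [|z p IH] x vx pH /=.
    by move=> /val_inj/val_inj ->; exact: rt_refl.
  move=> [xz vz zy]; have Hz : H z by apply: pH; left.
  have vz' : (~` star v) (ivert Hz) by move=> /stE.
  apply: (rt_trans _ _ _ (ivert vz')); first exact: rt_step.
  by apply: IH => // u pu; apply: pH; right.
- by move=> x y z [xy yz xz]; apply: (tf (val x) (val y) (val z)).
- exists (fun i => ivert (Hf i)); split; first by move=> i j /(congr1 val)/fI.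
  by move=> i j; exact: fE.
Qed.

(** * Galois types *)

Section Types.
Variable M : groupType.
Implicit Types A : set M.

Lemma automorphism_comp (f g : M -> M) :
  automorphism f -> automorphism g -> automorphism (g \o f).
Proof.
move=> [fb fM] [gb gM]; split; first exact: bij_comp.
by move=> x y /=; rewrite fM gM.
Qed.

Lemma automorphism_id : automorphism (@id M).
Proof. by split=> //; exists id. Qed.

Lemma automorphism_conj (g : M) : automorphism (fun x => x ^ g).
Proof. by split; [exact: conjg_bij | exact: conjg_morph]. Qed.

Lemma gtp_eq A (I : Type) (a b : I -> M) : gtp A a b -> gtp A a = gtp A b.
Proof.
move=> [f [[[f' fK fK'] fM] fA fa]]; apply/predeqP => d; split=> -[g [ga gA gad]].
  exists (g \o f'); split=> /=.
  - apply: automorphism_comp => //; split; first by exists f.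
    by move=> x y; apply: (can_inj fK); rewrite fM !fK'.
  - by move=> x Ax; rewrite -{1}(fA _ Ax) fK gA.
  - by move=> i; rewrite -fa fK.
exists (g \o f); split=> /=.
- by apply: automorphism_comp => //; split=> //; exists f'.
- by move=> x Ax; rewrite fA // gA.
- by move=> i; rewrite fa.
Qed.

Lemma gtp_refl A (I : Type) (a : I -> M) : gtp A a a.
Proof. by exists id; split=> //; exact: automorphism_id. Qed.

Lemma fin_gtp_eq A n (a b : 'I_n -> M) : fin_gtp A a = fin_gtp A b -> gtp A a b.
Proof.
move=> h; have E := Eqdep_dec.inj_pair2_eq_dec _ PeanoNat.Nat.eq_dec _ _ _ _ h.
by rewrite E; exact: gtp_refl.
Qed.

Definition commuting_types A : set (fin_type M) :=
  [set t | exists x y, commute x y /\ t = fin_gtp A (pair_tuple x y)].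

Lemma commuting_typesP A x y :
  commuting_types A (fin_gtp A (pair_tuple x y)) <-> commute x y.
Proof.
split=> [[x' [y' [cxy /esym/fin_gtp_eq[f [[_ fM] _ fE]]]]]|cxy]; last by exists x, y.
have := fE ord0; have := fE (ordS ord0); rewrite /pair_tuple /= => <- <-.
by rewrite /commute -!fM cxy.
Qed.

End Types.

(** * The independence property and instability *)

Definition discrete (V : Type) : graph :=
  @Graph V (fun _ _ => False) (fun _ _ h => h) (fun _ h => h).

Lemma K0'_discrete (V : Type) : K0' (tree_graph (discrete V)).
Proof. by apply: K0'_tree => x y z []. Qed.

(** The [a i] are pairwise non-adjacent, so a vertex joined to any prescribed set of them creates no
    triangle and can be found in [M]. *)
Lemma independent_family (M : groupType) (V L : Type) : monster K0 M ->
  infinite_set [set: L] -> card_lt [set: L] [set: M] -> embeds V L ->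
  exists (A : set M) (a : V -> M), [/\ K0 A, strong_sub A [set: M],
    A #<= [set: L], injective a /\ (forall i, A (a i)) &
    forall X : set V, exists b, forall i, commute b (a i) <-> X i].
Proof.
move=> hM Linf LM VL; pose Gm := tree_graph (discrete V).
have GL : embeds Gm L by exact: embeds_tree.
have RL : embeds (racg Gm) L by exact: embeds_racg.
have [Dm [c [e [_ hc he]]]] := monster_embed hM (K0'_discrete V) (embeds_lt RL LM).
have hce := psys_sub he (proj1 hc).
have [BI Badj] := Base_emb (discrete V).
exists (spanned (c \o e)), (fun i => c (e (Base (i : discrete V)))); split.
- exact: psys_K0 hce (K0'_discrete V).
- exact: spanned_strong.
- apply: card_le_trans (embeds_card RL).
  suff -> : spanned (c \o e) = (fun g : racg Gm => cev (c \o e) (racg_repr g)) @` setT.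
    exact: card_image_le.
  apply/predeqP => x; split=> [[w <-]|[g _ <-]]; last by exists (racg_repr g).
  by exists (racg_pi w) => //; apply/(psys_eqP _ _ hce); exact: racg_repr_pi.
- split=> [i j /(psys_inj hce)/BI //|i].
  by exists [:: Base (i : discrete V)]; rewrite cev1.
move=> X; pose X' : set Gm := [set x | exists2 i : discrete V, X i & x = Base i].
have [|d hd dE] := @monster_cone M hM L Gm Dm c e X' Linf LM GL hc he (K0'_discrete V).
  by move=> _ _ [i _ ->] [j _ ->] /Badj.
exists (d (apex X')) => i; rewrite -dE cone_commute //.
by split=> [[j Xj /BI ->]|Xi] //; exists i.
Qed.

Lemma monster_independence (M : groupType) : monster K0 M -> independence_property M.
Proof.
move=> hM; exists set0, (commuting_types set0); split; first exact: finite_set0.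
  by move=> _ [x [y [_ ->]]]; exists 2%nat, (pair_tuple x y).
move=> alpha lt; have [_ unc _ _] := hM.
have [L [Linf LM aL]] := embeds_infinite unc lt.
have [A [a [_ _ _ _ aP]]] := independent_family hM Linf LM aL.
exists a => X; have [b bP] := aP X; exists b => i.
by rewrite commuting_typesP.
Qed.

Lemma no_injection_powerset (L : Type) (f : set L -> L) : ~ injective f.
Proof.
move=> fI; pose D := [set x | exists2 X, f X = x & ~ X x].
have [fD|nfD] := pselect (D (f D)); last by apply: (nfD); exists D.
by have [X /fI -> ] := fD.
Qed.

Lemma monster_unstable (M : groupType) : monster K0 M -> unstable K0 M.
Proof.
move=> hM L Linf LM st.
have LL : embeds L L by exists id.
have [A [a [KA sA AL [aI aA] aP]]] := independent_family hM Linf LM LL.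
have AeL : A #= [set: L].
  rewrite card_eq_le AL /=; apply: card_le_trans (subset_card_le (B := A) _).
    have /card_esym := @inj_card_eq _ _ setT a (in2W aI).
    by rewrite card_eq_le => /andP[h _]; exact: h.
  by move=> _ [i _ <-].
have [b bP] := choice aP.
have /card_leP[F] := st A KA sA AeL.
pose t X : galois_types A := exist (fun y => y \in galois_types A)
  (fin_gtp A (fun _ : 'I_1 => b X)) (mem_set (ex_intro _ 1%nat (ex_intro _ _ erefl))).
have tI : injective t.
  move=> X Y /(congr1 val) /= /fin_gtp_eq[f [[[f' fK _] fM] fA fE]].
  (* [X] is recovered from the type of [b X] over [A] as the set of those [i] for which a
     realization commutes with [a i]. *)
  apply/predeqP => i; rewrite -!bP -(fE ord0) -{2}(fA _ (aA i)).
  by rewrite (morph_commute _ _ fM (can_inj fK)).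
apply: (@no_injection_powerset L (fun X => val (F (t X)))) => X Y /val_inj FXY.
by apply: tI; exact: (@inj _ _ _ F _ _ (mem_set I) (mem_set I) FXY).
Qed.

(** * Failure of homogeneity *)

Section Kill.
Variables (Gm : graph) (G : groupType) (c : Gm -> G) (hc : coxsys c).

Lemma inPM U g h : inP c U g -> inP c U h -> inP c U (g * h).
Proof. by move=> [u uU <-] [v vU <-]; exists (u ++ v); rewrite ?cev_cat // all_cat uU. Qed.

Lemma inPV U g : inP c U g -> inP c U g^-1.
Proof. by move=> [u uU <-]; exists (rev u); rewrite ?all_rev // (cev_rev hc). Qed.

Lemma inPc U x : U x -> inP c U (c x).
Proof. by move=> Ux; rewrite -[c x]mulg1; apply: inPcM => //; exact: inP1. Qed.

Lemma inPS U V g : U `<=` V -> inP c U g -> inP c V g.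
Proof.
move=> UV gU; elim/inP_ind: g / gU => [|x g Ux _ IH]; first exact: inP1.
by apply: inPcM => //; exact: UV.
Qed.

(** Deleting the letters [t] fixes the words [u] and [v], and turns [t u t] into [u]. *)
Lemma conj_kill t y : inP c (~` [set t]) y -> inP c (~` [set t]) (y ^ c t) -> y ^ c t = y.
Proof.
move=> [u uU <-] [v vU vE].
have ft w : all (fun z => `[< (~` [set t]) z >]) w ->
    [seq z <- w | `[< (~` [set t]) z >]] = w by move/all_filterP.
have : weq v ([:: t] ++ u ++ [:: t]).
  apply/(psys_eqP _ _ (proj1 hc)); rewrite vE conjgE (cinv hc) !cev_cat cev1.
  by [].
move=> /(weq_filter (fun z => `[< (~` [set t]) z >])).
rewrite !filter_cat ft //= ft // asboolF /= ?cats0; last by apply.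
by rewrite -vE => /(psys_eqP _ _ (proj1 hc)).
Qed.

Lemma inP_cofinite (t : nat -> Gm) g : injective t ->
  exists K, forall k, (K <= k)%nat -> inP c (~` [set t k]) g.
Proof.
move=> tI; elim/(cword_ind hc): g => [|x g [K KP]].
  by exists 0 => k _; exact: inP1.
have [[m xm]|nx] := pselect (exists m, x = t m); last first.
  by exists K => k /KP kg; apply: inPcM => // xk; apply: nx; exists k.
exists (maxn K m.+1) => k; rewrite geq_max => /andP[/KP kg mk]; apply: inPcM => //.
by rewrite xm => /tI mE; rewrite mE ltnn in mk.
Qed.

End Kill.

(** The pairs [(n, false)] and [(m, true)] become the vertices [s n] and [t m]. *)
Definition half_adj (x y : nat * bool) : Prop :=
  (~~ x.2 /\ y.2 /\ (x.1 < y.1)%nat) \/ (x.2 /\ ~~ y.2 /\ (y.1 < x.1)%nat).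

Lemma half_adj_sym x y : half_adj x y -> half_adj y x.
Proof. by case=> [[? []]|[? []]]; [right|left]. Qed.

Lemma half_adj_irr x : ~ half_adj x x.
Proof. by rewrite /half_adj ltnn; case=> [[_ [_]]|[_ [_]]]. Qed.

Definition half_graph : graph := Graph half_adj_sym half_adj_irr.

Lemma half_triangle_free : triangle_free half_graph.
Proof.
move=> x y z /= []; rewrite /half_adj.
by case: x.2; case: y.2; case: z.2 => //= -[[]|[]] // _ [] // _ _ [[]|[]] // _ [] // _ _ [[]|[]] // _ [].
Qed.

Lemma monster_half_graph (M : groupType) : monster K0 M ->
  exists (Dm : graph) (c : Dm -> M) (s t : nat -> Dm), [/\ K0' Dm, coxsys c,
    injective t, (forall n m, adj (s n) (t m) <-> (n < m)%nat) &
    (forall n m, ~ adj (s n) (s m)) /\ (forall n m, s n <> t m)].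
Proof.
move=> hM; have [_ unc _ _] := hM.
have KG := K0'_tree half_triangle_free.
have RL : embeds (racg (tree_graph half_graph)) nat.
  apply: (embeds_racg infinite_nat); apply: (embeds_tree infinite_nat).
  by exists pickle; exact: (pcan_inj pickleK).
have [Dm [c [e [KD hc [eI eadj]]]]] := monster_embed hM KG (embeds_lt RL unc).
have [BI Badj] := Base_emb half_graph.
exists Dm, c, (fun n => e (Base ((n, false) : half_graph))),
  (fun n => e (Base ((n, true) : half_graph))).
split=> //.
- by move=> n m /eI/BI[].
- move=> n m; rewrite eadj Badj /= /half_adj /=; split; last by left.
  by case=> [[_ []]|[]].
split=> n m; last by move=> /eI/BI.
by rewrite eadj Badj /= /half_adj /=; case=> [[_ []]|[]].
Qed.

Section Sequences.
Variables (M : groupType) (Dm : graph) (c : Dm -> M) (s t : nat -> Dm).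
Hypotheses (hc : coxsys c) (tI : injective t).
Hypothesis st : forall n m, adj (s n) (t m) <-> (n < m)%nat.
Hypothesis sNt : forall n m, s n <> t m.

Fixpoint tprod (n : nat) : M := if n is m.+1 then tprod m * c (t m) else 1.

(** The factors [t m] with [m] above [n] commute with [s n], so conjugating by a longer product has
    the same effect; this is [twisted_conj]. *)
Definition twisted (n : nat) : M := c (s n) ^ (tprod n.+1)^-1.

Lemma twisted_conj n m : (n < m)%nat -> c (s n) ^ (tprod m)^-1 = twisted n.
Proof.
move=> /subnK <-; elim: (m - n.+1)%nat => [//|k IH].
rewrite addSn [tprod _.+1]/= invgM conjgM (cinv hc).
rewrite [c (s n) ^ _]conjg_commute //.
by apply: (psysC (proj1 hc)); apply/st; rewrite addnS ltnS leq_addl.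
Qed.

Lemma tprod_inP n k : (n <= k)%nat -> inP c (~` [set t k]) (tprod n).
Proof.
elim: n => [|n IH] nk; first exact: inP1.
apply: inPM; first by apply: IH; exact: ltnW.
by apply: inPc => /tI nE; rewrite nE ltnn in nk.
Qed.

(** For large [K], neither [x] nor its conjugate [y] involves [t K]. The conjugate of [y] by
    [c (t K)] centralizes [c (s K)], and [t K] is not adjacent to [s K], so it does not involve
    [t K] either; by [conj_kill] it equals [y]. *)
Lemma twisted_centralizer x : (forall n, commute x (twisted n)) ->
  exists k, commute x (c (t k) ^ (tprod k)^-1).
Proof.
move=> xa; have [K /(_ K (leqnn K)) xK] := inP_cofinite hc x tI.
exists K; pose y := x ^ tprod K.
have yP : inP c (~` [set t K]) y.
  by apply: inPM; [apply: inPV => //; exact: tprod_inP|apply: inPM => //; exact: tprod_inP].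
have yE : y ^ c (t K) = y.
  apply: conj_kill => //; rewrite -conjgM.
  apply: (@inPS _ _ _ (star (s K))).
    by move=> z [-> /sNt//|sz zt]; move: sz; rewrite zt st ltnn.
  apply: (centralizer hc); apply/(conj_commute _ _ (tprod K.+1)^-1).
  by rewrite conjgK; exact: xa.
apply/(conj_commute _ _ (tprod K)); rewrite conjgKV.
by rewrite /commute -/y [LHS]conjgC yE.
Qed.

End Sequences.

Lemma leq_well_order : wochoice.well_order leq.
Proof.
apply: wochoice.antisymmetric_well_order; first exact: anti_leq.
move=> A [n nA]; have h : exists n, n \in A by exists n.
by case: (ex_minnP h) => m mA mP; exists m; split.
Qed.

Lemma seq_lift (T : Type) (H : set T) (w : seq T) : letters w `<=` H ->
  exists w' : seq H, map val w' = w.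
Proof.
elim: w => [|x w IH] wH; first by exists [::].
have [|w' <-] := IH; first by move=> y yw; apply: wH; right.
have Hx : H x by apply: wH; left.
by exists (exist (fun y => y \in H) x (mem_set Hx) :: w').
Qed.

Lemma monster_not_homogeneous (M : groupType) : monster K0 M -> ~ homogeneous M.
Proof.
move=> hM homog; have [_ unc _ _] := hM.
have [Dm [c [s [t [KD hc tI st [ss sNt]]]]]] := monster_half_graph hM.
pose a := twisted c s t.
have [f [[[f' fK fK'] fM] _ fs]] : gtp set0 (fun n => c (s n)) a.
  (* The ordinal is omega; uncountability of [M] says exactly that it is smaller than [M]. *)
  rewrite (homog (OrdinalNumber leq_well_order) unc (fun n => c (s n)) a).
    exact: gtp_refl.
  move=> X Xfin; apply: gtp_eq.
  have [m mP] : exists m, forall i, X i -> (i < m)%nat.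
    have /finite_seqP[r rX] := Xfin; exists (\max_(i <- r) i).+1 => i.
    rewrite rX /= => ir; rewrite ltnS.
    by rewrite (big_rem i) //= leq_maxl.
  exists (fun x => x ^ (tprod c t m)^-1); split=> //; first exact: automorphism_conj.
  by move=> i; apply: twisted_conj => //; apply: mP; exact: (set_mem (valP i)).
pose y k := f' (c (t k) ^ (tprod c t k)^-1).
have [H [AH cH KH]] : exists H, [/\ range s `|` \bigcup_(k in setT) letters (wd hc (y k))
    `<=` H, countable H & K0' (induced H)].
  apply: countable_K0' => //; rewrite -bigcup2E; apply: bigcup_countable => //.
  move=> [|[|k]] _ //=.
    by apply: sub_countable (countableP [set: nat]); exact: card_image_le.
  by apply: bigcup_countable => // k _; exact: countable_letters.
have HL : embeds (induced H) nat.
  have /countable_injP[i iI] := cH; exists (fun x => i (val x)) => x z xz.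
  by apply: val_inj; apply: iI xz; exact: valP.
pose X : set (induced H) := [set x | exists n, val x = s n].
have [|d hd dE] := @monster_cone M hM nat _ _ c _ X infinite_nat unc HL hc
    (induced_val_emb H) KH.
  by move=> x z [n xn] [m zm]; rewrite /= xn zm; exact: ss.
have Hs n : H (s n) by apply: AH; left; exists n.
pose b := d (apex X).
have bs n : commute b (c (s n)).
  rewrite -[s n]/(val (ivert (Hs n))) -dE; apply/cone_commute => //.
  by exists n.
have [k fbk] : exists k, commute (f b) (c (t k) ^ (tprod c t k)^-1).
  apply: (twisted_centralizer hc tI st sNt) => n; rewrite -/(a n) -fs.
  by apply/(morph_commute _ _ fM (can_inj fK)).
have [w wE] : exists w : seq (induced H), map val w = wd hc (y k).
  by apply: seq_lift => z zw; apply: AH; right; exists k.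
have dval u : cev (d \o cone_base X) u = cev c (map val u).
  rewrite (cev_map c (fun x : induced H => val x : Dm)) /cev.
  by apply: eq_bigr => x _; exact: dE.
have [|w' w'X w'E] := @cone_centralizer _ X _ d w hd.
  rewrite dval wE (wdK hc); apply/(morph_commute _ _ fM (can_inj fK)).
  by rewrite /y fK'.
(* [f] sends each [c (s n)] to a conjugate of it, with coordinate 0 at [t k], whereas [f (y k)] is a
   conjugate of [c (t k)]. *)
have : chi hc (t k) (f (y k)) = false.
  rewrite -(wdK hc (y k)) -wE -dval w'E dval.
  elim: w' w'X {w'E} => [_|x u IH /= /andP[/asboolP[n xn] /IH uP]].
    by rewrite cev_nil (morph1 fM) chi1.
  by rewrite cev_cons fM chiM uP addbF xn fs chiJ chic asboolF //.
by rewrite /y fK' chiJ chic asboolT.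
Qed.

Theorem theorem5p8 (M : groupType) (M_monster : monster K0 M) :
  ~ homogeneous M /\ (independence_property M /\ unstable K0 M).
Proof.
split; first exact: monster_not_homogeneous.
split; [exact: monster_independence | exact: monster_unstable].
Qed.
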